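(* Let $G_n^1,G_n^2$ be two independent random graphs, each uniformly distributed on the set of all graphs with vertex set $[n]=\{1,\dots,n\}$. Then with probability tending to $1$ as $n\to\infty$ (over the choice of $G_n^1,G_n^2$) the following holds: for every $u_1,u_2\in[n]$, for (Lebesgue-)almost all $\varepsilon\in(0,1)$, $S^{(2)}$ distinguishes between $(G_n^1,u_1)$ and $(G_n^2,u_2)$ for the noisy voter model with noise $\varepsilon$.
   Context: The noisy voter model is considered on connected graphs; $G_n^1$ and $G_n^2$ are connected with probability tending to $1$, and the event in the claim is understood to include their connectedness. Noisy voter model (NVM) with noise $\varepsilon\in(0,1)$ on a connected (locally finite, with at least two vertices) graph $G$: let $N_G(u)$ be the set of neighbors of $u$. At time $0$, $X_0(u)\sim\mathrm{Bern}(1/2)$ independently over all $u\in V(G)$. For every $t\ge 1$ and $u\in V(G)$, $$X_t(u)=\xi_t(u)Y_t(u)+(1-\xi_t(u))\sum_{v\in N_G(u)}I(\eta_t(u)=v)X_{t-1}(v),$$ where $\xi_t(u)\sim\mathrm{Bern}(\varepsilon)$, $Y_t(u)\sim\mathrm{Bern}(1/2)$, $\eta_t(u)$ is uniform on $N_G(u)$, and all the variables $\xi_t(u),Y_t(u),\eta_t(u)$ ($t\ge1$, $u\in V(G)$) and $X_0(u)$ ($u\in V(G)$) are independent. Write $X_t(G,u)=X_t(u)$. Distinguishability: let $(G_1,u_1),(G_2,u_2)$ be (fixed) rooted graphs, both running the NVM with the same $\varepsilon$. A sequence $S=(S_t)_{t}$, where $S_t$ is a real-valued function of the observations up to time $t$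 at a vertex, distinguishes between them if there are sets $\mathcal S_1(t),\mathcal S_2(t)\subset\mathbb R$, disjoint for each $t$, such that $$\mathsf P\big[S_t(X_i(G_1,u_1),\,i\le t)\in\mathcal S_1(t),\ S_t(X_i(G_2,u_2),\,i\le t)\in\mathcal S_2(t)\big]\to1\quad (t\to\infty).$$ Repetition statistic: for $d\in\mathbb N$ and $t>d$, $S^{(d)}_t=\frac1{t-d}\sum_{i=1}^{t-d}I(X_i(u)=X_{i+d}(u))$, where $u$ is the observed vertex, and $S^{(d)}=(S^{(d)}_t)_t$. *)

(* Defs.v *)
From HB Require Import structures.
From mathcomp Require Import all_boot all_order all_algebra.
From mathcomp Require Import all_classical all_reals all_analysis.
Set Implicit Arguments.
Unset Strict Implicit.
Unset Printing Implicit Defensive.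
Import Order.TTheory GRing.Theory Num.Theory.
Import numFieldNormedType.Exports.

Local Open Scope classical_set_scope.
Local Open Scope ring_scope.

(** Finite simple graphs on [V], given by their set of edges (pairs of distinct
    vertices). Labelled graphs are compared by Leibniz equality, and
    [#|{: sgraph V}|] is the number of all graphs with vertex set [V]. *)
Definition sgraph (V : finType) : Type :=
  {E : {set {set V}} | [forall e in E, #|e| == 2]}.

HB.instance Definition _ (V : finType) := Finite.on (sgraph V).

(* [[set u; u]] has one element, so [adj G] is irreflexive. *)
Definition adj (V : finType) (G : sgraph V) : rel V :=
  fun u v => [set u; v]%SET \in val G.

Definition neighbours (V : finType) (G : sgraph V) (u : V) : {set V} :=
  [set v | adj G u v]%SET.

Definition connected_graph (V : finType) (G : sgraph V) : Prop :=
  forall u v : V, connect (adj G) u v.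

Section RandomElements.
Context {d : measure_display} {T : measurableType d} {R : realType}.
Variable P : probability T R.

(** [Z] is a random element of the finite set [E] (all subsets of [E] being
    measurable) with probability mass function [p]. *)
Definition has_pmf (E : finType) (Z : T -> E) (p : E -> R) : Prop :=
  forall z, measurable (Z @^-1` [set z]) /\ P (Z @^-1` [set z]) = (p z)%:E.

(** The sigma-algebra generated by a random element of a discrete set. *)
Definition events_of (E : Type) (Z : T -> E) : set_system T :=
  [set Z @^-1` B | B in [set: set E]].

(** Mutual independence of a family of sigma-algebras: the product rule over
    every finite subfamily. *)
Definition mutually_independent (I : eqType) (F : I -> set_system T) : Prop :=
  forall (J : seq I) (A : I -> set T), uniq J ->
    (forall i, i \in J -> F i (A i)) ->
    P (\bigcap_(i in [set` J]) A i) = (\prod_(i <- J) P (A i))%E.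

End RandomElements.

Definition uniform_pmf (R : realType) (E : finType) (A : {set E}) (z : E) : R :=
  if z \in A then #|A|%:R^-1 else 0.

Section NoisyVoterModel.
Context {d : measure_display} {T : measurableType d} {R : realType}.
Variables (P : probability T R) (eps : R) (V : finType) (G : sgraph V).

(** The events generated by each of the variables driving the model. In the
    last three summands, the index [(t, u)] stands for the variable at vertex
    [u] and time [t.+1], so that times range over [t >= 1]. *)
Definition driving_events (X0 : V -> T -> bool) (xi Y : nat -> V -> T -> bool)
    (eta : nat -> V -> T -> V)
    (i : V + (nat * V + (nat * V + nat * V))) : set_system T :=
  match i with
  | inl u => events_of (X0 u)
  | inr (inl (t, u)) => events_of (xi t.+1 u)
  | inr (inr (inl (t, u))) => events_of (Y t.+1 u)
  | inr (inr (inr (t, u))) => events_of (eta t.+1 u)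
  end.

(** [X t u] is the state of vertex [u] at time [t]. The booleans are coerced to
    0 and 1 in the recursion. *)
Definition noisy_voter_model (X : nat -> V -> T -> bool) : Prop :=
  [/\ connected_graph G, (2 <= #|V|)%N &
   exists (xi Y : nat -> V -> T -> bool) (eta : nat -> V -> T -> V),
   [/\ forall u, has_pmf P (X 0%N u) (bernoulli_pmf 2^-1),
       forall t u, (1 <= t)%N ->
         [/\ has_pmf P (xi t u) (bernoulli_pmf eps),
             has_pmf P (Y t u) (bernoulli_pmf 2^-1) &
             has_pmf P (eta t u) (uniform_pmf R (neighbours G u))],
       mutually_independent P (driving_events (X 0%N) xi Y eta) &
       forall t u w, (1 <= t)%N ->
         X t u w = (xi t u w * Y t u w + (1 - xi t u w) *
           \sum_(v in neighbours G u) (eta t u w == v) * X t.-1 v w)%N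
         :> nat]].

End NoisyVoterModel.

(** [S t] is a function of the observations at times [0, ..., t]. *)
Definition statistic (R : realType) : Type :=
  forall t : nat, ('I_t.+1 -> bool) -> R.

Definition repetition_statistic (R : realType) (d : nat) : statistic R :=
  fun t x => (t - d)%N%:R^-1 *
    \sum_(1 <= i < (t - d).+1) (x (inord i) == x (inord (i + d)%N))%:R.

(** The two models may live on any common probability space, with any
    dependence between them: as the event is the intersection of one event per
    model, whether its probability tends to 1 depends only on the law of each
    model. *)
Definition distinguishes (R : realType) (S : statistic R) (eps : R)
    (V1 V2 : finType) (G1 : sgraph V1) (u1 : V1) (G2 : sgraph V2) (u2 : V2) :
    Prop :=
  exists S1 S2 : nat -> set R,
    (forall t, S1 t `&` S2 t = set0) /\
    forall (d : measure_display) (T : measurableType d) (P : probability T R)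
      (X1 : nat -> V1 -> T -> bool) (X2 : nat -> V2 -> T -> bool),
      noisy_voter_model P eps G1 X1 -> noisy_voter_model P eps G2 X2 ->
      (fun t => P [set w | S1 t (S t (fun i => X1 i u1 w)) /\
                           S2 t (S t (fun i => X2 i u2 w))]) @ \oo --> 1%E.

(* Main.v *)
(** The autocorrelation at lag 2 of a vertex u is governed by duality: with
    a = (1 - eps)^2, spins +1/-1 and p the walk kernel, the correlation of two
    vertices at the same time obeys C(v, v) = 1 and
    C(v, w) = a \sum p(v, v') p(w, w') C(v', w') for v <> w, so it converges
    geometrically, from any initial state, to the unique fixed point.  Hence
    S^(2) converges in probability to (1 + a \sum_v p^2(u, v) C(u, v)) / 2.
    By Cramer's rule this is a rational function of a, with p^2(u, u) as value at
    a = 0 of the sum, so two rooted graphs are distinguished for all but finitely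
    many eps as soon as their return probabilities
    p^2(u, u) = (1 / d_u) \sum_{w ~ u} 1 / d_w differ.

    It remains to see that in a random graph p^2(u, u) hits a given value with
    probability o(n^-2), since there are n^2 pairs of roots.  Resample the edges
    between a bounded number of neighbours w of u and the non-neighbours of u:
    the degrees d_w become independent shifted binomials.  Split these w into
    blocks of k.  In a block where the degrees have pairwise small gcds there are
    few solutions x of \sum 1 / x_i = y: given one solution, each x_i of another
    one divides the product of all the given x_j up to a small factor, and the
    divisor bound applies.  So such a block has a prescribed sum with probability
    n^(-ck).  A large gcd occurs in a block with probability n^(-c), and in all of
    many blocks with probability o(n^-2). *)

Require Import Defs.
From HB Require Import structures.
From mathcomp Require Import all_boot all_order all_algebra.
From mathcomp Require Import all_classical all_reals all_analysis.
From mathcomp Require Import zify ring lra.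
Set Implicit Arguments.
Unset Strict Implicit.
Unset Printing Implicit Defensive.
Import Order.TTheory GRing.Theory Num.Theory.
Import numFieldNormedType.Exports.

(** * Binomial coefficients and numbers of divisors *)

Lemma leq_bin_half (n j : nat) : 'C(n, j) <= 'C(n, n./2).
Proof.
wlog jn : j / j <= n./2 => [H|].
  case: (leqP j n./2) => [|jn]; first exact: H.
  case: (leqP j n) => [jn'|/bin_small -> //].
  rewrite -bin_sub //; apply: H; lia.
have [m mE] : exists m, m = n./2 - j by exists (n./2 - j).
elim: m j jn mE => [|m IH] j jn mE; first by have -> : j = n./2 by lia.
apply: leq_trans (IH j.+1 _ _); [|lia|lia].
have := mul_bin_left n j; nia.
Qed.

(** Passing from [m] to [m.+1] multiplies the central coefficient by 2(2m+1)/(m+1), and (2m+1)(2m+3)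
    <= 4(m+1)^2. *)
Lemma central_bin_sqr (m : nat) : 'C(m.*2, m) ^ 2 * m.*2.+1 <= 16 ^ m.
Proof.
elim: m => [|m IH] //.
have E : m.+1 * 'C(m.+1.*2, m.+1) = 2 * m.*2.+1 * 'C(m.*2, m).
  have h1 := mul_bin_diag m.*2.+2 m.
  have h2 := mul_bin_down m.*2.+1 m.
  have -> : m.+1.*2 = m.*2.+2 by [].
  rewrite /= in h1 h2.
  have e : (m.*2.+1 - m) = m.+1 by lia.
  rewrite e in h2; nia.
rewrite (expnS 16).
set a := 'C(m.*2, m) in E IH *; set b := 'C(_, _) in E *.
rewrite -(leq_pmul2l (m := m.+1 ^ 2)) ?expn_gt0 //.
have -> : m.+1 ^ 2 * (b ^ 2 * m.+1.*2.+1) = (m.+1 * b) ^ 2 * m.+1.*2.+1.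
  by rewrite expnMn mulnA.
rewrite E.
have -> : (2 * m.*2.+1 * a) ^ 2 * m.+1.*2.+1
   = (a ^ 2 * m.*2.+1) * (4 * m.*2.+1 * m.+1.*2.+1) by ring.
apply: (@leq_trans (16 ^ m * (4 * m.*2.+1 * m.+1.*2.+1))).
  by rewrite leq_mul2r IH orbT.
have -> : m.+1 ^ 2 * (16 * 16 ^ m) = 16 ^ m * (m.+1 ^ 2 * 16) by ring.
rewrite leq_mul2l; apply/orP; right; nia.
Qed.

(** An atom of Bin(s, 1/2) is at most 1/sqrt(s); squaring keeps the bound in the integers. Odd [s] =
    2m+1 reduces to the even case by C(2m+2, m+1) = 2 C(2m+1, m). *)
Lemma bin_sqr_bound (s j : nat) : 'C(s, j) ^ 2 * s <= 4 ^ s.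
Proof.
apply: (@leq_trans ('C(s, s./2) ^ 2 * s)).
  by rewrite leq_mul2r leq_sqr leq_bin_half orbT.
have := odd_double_half s; case: (odd s) => /= sE.
- set m := s./2 in sE *.
  have e1 : 'C(m.+1.*2, m.+1) = 2 * 'C(s, m).
    have -> : m.+1.*2 = s.+1 by lia.
    rewrite binS mul2n -addnn; congr (_ + _).
    rewrite -bin_sub; last lia. congr ('C(_, _)); lia.
  have := central_bin_sqr m.+1; rewrite e1.
  have -> : 16 ^ m.+1 = 4 * 4 ^ s.
    by rewrite -expnS (_ : 16 = 4 ^ 2) // -expnM; congr (_ ^ _); lia.
  rewrite expnMn; nia.
- set m := s./2 in sE *.
  have := central_bin_sqr m.
  have -> : 16 ^ m = 4 ^ s.
    by rewrite (_ : 16 = 4 ^ 2) // -expnM; congr (_ ^ _); lia.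
  have -> : m.*2 = s by lia.
  nia.
Qed.

(** A divisor c of ab is gcd(c, a) times c / gcd(c, a), and the latter divides b. *)
Lemma size_divisorsM (a b : nat) : 0 < a -> 0 < b ->
  size (divisors (a * b)) <= size (divisors a) * size (divisors b).
Proof.
move=> a0 b0; rewrite -(size_allpairs muln); apply: uniq_leq_size.
  exact: divisors_uniq.
move=> c; rewrite -dvdn_divisors ?muln_gt0 ?a0 // => cab.
have c0 : 0 < c by apply: dvdn_gt0 cab; rewrite muln_gt0 a0.
have g0 : 0 < gcdn c a by rewrite gcdn_gt0 c0.
apply/allpairsP; exists (gcdn c a, c %/ gcdn c a); split => /=.
- by rewrite -dvdn_divisors // dvdn_gcdr.
- rewrite -dvdn_divisors //.
  have : coprime (c %/ gcdn c a) (a %/ gcdn c a).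
    rewrite /coprime -(eqn_pmul2l g0) muln_gcdr !(mulnC (gcdn c a)).
    by rewrite !divnK ?dvdn_gcdl ?dvdn_gcdr // mul1n.
  move=> /Gauss_dvdr <-.
  rewrite -(dvdn_pmul2l g0) mulnA !(mulnC (gcdn c a)).
  by rewrite !divnK ?dvdn_gcdl ?dvdn_gcdr // .
- by rewrite mulnC divnK // dvdn_gcdl.
Qed.

Lemma size_divisors_pfactor (p e : nat) : prime p ->
  size (divisors (p ^ e)) <= e.+1.
Proof.
move=> pp; rewrite -[X in _ <= X](size_mkseq (fun i => p ^ i)).
apply: uniq_leq_size; first exact: divisors_uniq.
move=> c; rewrite -dvdn_divisors ?expn_gt0 ?prime_gt0 //.
move=> /(dvdn_pfactor _ _ pp)[m me ->].
by apply/mapP; exists m => //; rewrite mem_iota.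
Qed.

Lemma expS_bound (E e : nat) : 0 < E -> e.+1 ^ E <= E ^ E * 2 ^ e.
Proof.
move=> E0.
have h : e.+1 <= E * 2 ^ (e %/ E).
  apply: (@leq_trans (E * (e %/ E).+1)).
    by rewrite mulnC; apply: ltn_ceil.
  by rewrite leq_mul2l ltn_expl ?orbT.
apply: (@leq_trans ((E * 2 ^ (e %/ E)) ^ E)); first by rewrite leq_exp2r.
by rewrite expnMn -expnM leq_mul2l leq_exp2l // leq_divM orbT.
Qed.

(** The divisor bound d(x) = O(x^(1/E)). A prime p >= 2^E pays for the factor 2^E that it
    contributes at each occurrence; each of the finitely many smaller primes costs at most a
    constant factor E^E, by [expS_bound]. *)
Lemma size_divisors_bound (E : nat) : 0 < E ->
  exists2 C, 0 < C & forall x, 0 < x -> size (divisors x) ^ E <= C * x.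
Proof.
move=> E0.
have rough x : 0 < x -> (forall p, prime p -> p %| x -> 2 ^ E <= p) ->
    size (divisors x) ^ E <= x.
  elim/ltn_ind: x => x IH x0 px.
  case: (leqP x 1) => x1.
    have -> : x = 1 by lia.
    by rewrite -[divisors 1]/[:: 1] exp1n.
  have pp := pdiv_prime x1; set p := pdiv x in pp.
  have xE : x = p * (x %/ p) by rewrite mulnC divnK // pdiv_dvd.
  have m0 : 0 < x %/ p by move: x0; rewrite {1}xE muln_gt0 => /andP[].
  have mx : x %/ p < x by rewrite ltn_Pdiv // prime_gt1.
  have h := IH _ mx m0 (fun q qp qx => px q qp (dvdn_trans qx (dvdn_div (pdiv_dvd x)))).
  rewrite {1}xE; apply: (@leq_trans ((2 * size (divisors (x %/ p))) ^ E)).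
    rewrite leq_exp2r //; apply: leq_trans (size_divisorsM (prime_gt0 pp) m0) _.
    by rewrite leq_mul2r -{1}(expn1 p) (size_divisors_pfactor 1 pp) orbT.
  by rewrite expnMn [X in _ <= X]xE leq_mul // px // pdiv_dvd.
pose C i := (E ^ E) ^ i.
have C0 i : 0 < C i by rewrite !expn_gt0 E0.
suff main i x : 0 < x -> (forall p, prime p -> p %| x -> 2 ^ E <= p + i) ->
    size (divisors x) ^ E <= C i * x.
  exists (C (2 ^ E)) => // x x0; apply: main => // p _ _; exact: leq_addl.
elim: i x => [|i IH] x x0 px.
  by rewrite /C expn0 mul1n; apply: rough => // p pp pd; rewrite -(addn0 p); apply: px.
pose p := (2 ^ E - i.+1).
case pp : (prime p); last first.
  apply: (@leq_trans (C i * x)).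
    apply: IH => // q qp qx; have := px _ qp qx.
    rewrite leq_eqVlt => /orP[/eqP e|]; last by lia.
    have qE : q = p by rewrite /p e; lia.
    by rewrite qE pp in qp.
  by rewrite leq_mul2r [C i.+1]expnS leq_pmull ?orbT // expn_gt0 E0.
have xE := partnC p x0; set a := x`_p in xE; set b := x`_p^' in xE.
have b0 : 0 < b by apply: part_gt0.
have hb : size (divisors b) ^ E <= C i * b.
  apply: IH => // q qp qb.
  have qx : q %| x by rewrite -xE dvdn_mull.
  have := px _ qp qx; rewrite leq_eqVlt => /orP[/eqP e|]; last by lia.
  have qE : q = p by rewrite /p e; lia.
  have : p^'.-nat b by apply: part_pnat.
  by move=> /(pnatP _ b0)/(_ q qp qb); rewrite qE !inE eqxx.
have aE : a = p ^ logn p x by rewrite /a p_part.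
rewrite -{1}xE.
apply: (@leq_trans ((size (divisors a) * size (divisors b)) ^ E)).
  by rewrite leq_exp2r // size_divisorsM // part_gt0.
rewrite expnMn -xE.
have ha : size (divisors a) ^ E <= E ^ E * a.
  rewrite aE; apply: (@leq_trans ((logn p x).+1 ^ E)).
    by rewrite leq_exp2r // size_divisors_pfactor.
  apply: leq_trans (expS_bound _ E0) _.
  rewrite leq_mul2l; apply/orP; right.
  by case: (logn p x) => // l; rewrite leq_exp2r // prime_gt1.
rewrite /C expnS mulnACA; exact: leq_mul.
Qed.

(** * Averaging over a resampled coordinate *)

Section Averaging.
Variables (R : realFieldType).

(** An injection of a finite set into itself preserves the uniform law, so the first component of
    [psi (g, w)] is uniform on [G]. Hence a bound on the conditional probability of [B] given each g
    is a bound on its probability. *)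
Lemma card_le_average (G W : finType) (psi : G * W -> G * W) (B : {pred G})
    (c : R) :
  injective psi -> (0 < #|W|)%N ->
  (forall g, #|[set w | B (psi (g, w)).1]|%:R <= c * #|W|%:R)%R ->
  (#|B|%:R <= c * #|G|%:R)%R.
Proof.
move=> psi_inj W0 h.
have E : #|B| * #|W| = \sum_g #|[set w | B (psi (g, w)).1]|.
  have -> : #|B| * #|W| = #|[set p : G * W | B p.1]|.
    rewrite -cardsT -[#|B|]cardsE -cardsX; apply: eq_card => -[g w].
    by rewrite !inE /= andbT.
  rewrite -(card_imset _ (can_inj (f_invF psi_inj))).
  under eq_bigr do rewrite -sum1_card.
  rewrite pair_big_dep /= -sum1_card; apply: eq_bigl => -[g w].
  rewrite inE /=; apply/imsetP/idP => [[p pB ->]|gB].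
    by rewrite f_invF /=; move: pB; rewrite inE.
  by exists (psi (g, w)); rewrite ?invF_f // inE.
have W0' : (0 < #|W|%:R :> R)%R by rewrite ltr0n.
rewrite -(ler_pM2r W0') -natrM E natr_sum.
apply: le_trans (ler_sum _ (fun g _ => h g)) _.
by rewrite sumr_const -[X in (X <= _)%R]mulr_natr mulrAC.
Qed.

(** Here [psi] exchanges coordinate [i] with a fresh independent value. *)
Lemma card_le_resample (I T : finType) (i : I) (B : {pred {ffun I -> T}})
    (c : R) :
  (0 < #|T|)%N ->
  (forall A : {ffun I -> T},
     #|[set t | B [ffun j => if j == i then t else A j]]|%:R <= c * #|T|%:R)%R ->
  (#|B|%:R <= c * #|{ffun I -> T}|%:R)%R.
Proof.
move=> T0 h.
pose psi (p : {ffun I -> T} * T) : {ffun I -> T} * T :=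
  ([ffun j => if j == i then p.2 else p.1 j], p.1 i).
apply: (@card_le_average _ _ psi) => //; apply: (can_inj (g := psi)) => -[A t].
rewrite /psi /= ffunE eqxx; congr (_, _); apply/ffunP => j; rewrite !ffunE.
by case: eqP => [->|].
Qed.

Lemma card_le_disjunction (T J : finType) (B : {pred T}) (C : J -> {pred T})
    (c : J -> R) :
  (forall x, B x -> exists j, C j x) ->
  (forall j, #|C j|%:R <= c j * #|T|%:R)%R ->
  (#|B|%:R <= (\sum_j c j) * #|T|%:R)%R.
Proof.
move=> BC h; rewrite mulr_suml.
apply: le_trans (ler_sum _ (fun j _ => h j)).
rewrite -natr_sum ler_nat.
have sumE (D : {pred T}) : #|D| = \sum_x (x \in D : nat).
  by rewrite -sum1_card big_mkcond; apply: eq_bigr => x _; case: (x \in D).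
rewrite sumE; under [X in _ <= X]eq_bigr do rewrite sumE.
rewrite exchange_big /=; apply: leq_sum => x _.
case: (boolP (x \in B)) => // /BC[j jC].
by rewrite (bigD1 j) //= unfold_in jC.
Qed.

End Averaging.

Lemma card_set_type (V : finType) : #|{set V}| = 2 ^ #|V|.
Proof. by rewrite -(cardsT V) -card_powerset powersetT cardsT. Qed.

Definition symd (T : finType) (A B : {set T}) : {set T} :=
  [set x | (x \in A) (+) (x \in B)]%SET.

Lemma symdK (T : finType) (B : {set T}) : involutive (fun A => symd A B).
Proof. by move=> A; apply/finset.setP => x; rewrite !inE -addbA addbb addbF. Qed.

Lemma symdKl (T : finType) (B : {set T}) : involutive (symd B).
Proof. by move=> A; apply/finset.setP => x; rewrite !inE addbA addbb. Qed.

Lemma symdAC (T : finType) (A B C : {set T}) :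
  symd (symd A B) C = symd (symd A C) B.
Proof. by apply/finset.setP => x; rewrite !inE addbAC. Qed.

(** Separates the part of the count that depends on the random set [B] from the part that is
    fixed. *)
Lemma card_symd_setI (V J : finType) (z : J -> V) (Z A : {set V}) (B : {set J}) :
  injective z -> (forall j, z j \in Z) ->
  #|symd A (z @: B) :&: Z|%SET =
  (#|A :&: (Z :\: z @: [set: J])|%SET + #|symd (z @^-1: A) B|%SET).
Proof.
move=> z_inj zZ; rewrite -(cardsID (z @: [set: J])%SET) addnC; congr (_ + _).
  apply: eq_card => v; rewrite !inE.
  case zv: (v \in z @: [set: J])%SET => /=; first by rewrite andbF.
  have -> : (v \in z @: B)%SET = false.
    apply/negbTE/imsetP => -[j _ vE]; move: zv; rewrite vE imset_f //.
  by rewrite addbF.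
rewrite -(card_imset _ z_inj); apply: eq_card => v; rewrite !inE.
apply/idP/imsetP => [|[j jB ->]].
  case/andP => /andP[vAB vZ] /imsetP[j _ vj]; exists j => //.
  by rewrite !inE; move: vAB; rewrite vj mem_imset.
rewrite zZ (imset_f z (finset.in_setT j)) !andbT mem_imset //.
by move: jB; rewrite !inE.
Qed.

(* If [Q] contains at most one of any [s + 1] consecutive integers, then flipping
   [s] elements of [Z] at random bounds the probability of [Q] by an atom of
   [Bin(s, 1/2)]. *)
Lemma card_anticoncentration (R : realFieldType) (V : finType) (Z N : {set V})
    (b s : nat) (Q : pred nat) (al : R) :
  (s <= #|Z|) -> (0 <= al)%R -> (1 <= al ^+ 2 * s%:R)%R ->
  (forall c i j, i <= s -> j <= s -> Q (c + i) -> Q (c + j) -> i = j) ->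
  (#|[set A : {set V} | Q (b + #|symd A N :&: Z|)%N]|%SET%:R <=
     al * #|{set V}|%:R)%R.
Proof.
move=> sZ al0 als Q1.
have s0 : 0 < s by case: s als {sZ Q1} => //; rewrite mulr0 ler10.
have [z z_inj zZ] : exists2 z : 'I_s -> V, injective z & forall j, z j \in Z.
  exists (fun j => enum_val (widen_ord sZ j)) => [i j /enum_val_inj|j].
    by move=> /(congr1 val) /= /val_inj.
  exact: enum_valP.
pose psi (p : {set V} * {set 'I_s}) := (symd p.1 (z @: p.2), p.2).
rewrite cardsE; apply: (card_le_average (W := {set 'I_s}) (psi := psi)).
- apply: (can_inj (g := psi)) => -[A B]; rewrite /psi /=; congr (_, _); exact: symdK.
- by rewrite card_set_type expn_gt0.
move=> A /=.
set S := [set w | _]%SET.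
have [S0|[B0 B0S]] := set_0Vmem S.
  by rewrite S0 cards0 mulr_ge0.
set P := (z @^-1: symd A N)%SET.
set c := b + #|symd A N :&: (Z :\: z @: [set: 'I_s])|%SET.
have SE B : (B \in S) = Q (c + #|symd P B|).
  by rewrite !inE /psi /= symdAC (card_symd_setI _ _ z_inj zZ) addnA.
have lts (B : {set 'I_s}) : #|B| <= s by rewrite -[s in _ <= s]card_ord max_card.
(* All sets in [S] give the same size of [symd P B] as [B0], because the possible sizes range over s
   + 1 consecutive integers. As [symd P] is injective, [S] has at most as many elements as there are
   sets of that size. *)
apply: (@le_trans _ _ ('C(s, #|symd P B0|)%:R)%R).
  rewrite ler_nat -[s in 'C(s, _)]card_ord -card_draws.
  rewrite -(card_imset S (can_inj (symdKl P))).
  apply: subset_leq_card; apply/fintype.subsetP => _ /imsetP[B BS ->].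
  rewrite inE; apply/eqP; apply: (Q1 c); rewrite ?lts // -SE //.
set k := #|_| in B0S *.
rewrite card_set_type card_ord.
have h := bin_sqr_bound s k.
have h' : ('C(s, k)%:R ^+ 2 * s%:R <= 4 ^+ s :> R)%R.
  by rewrite -!natrX -natrM ler_nat.
have s0' : (0 < s%:R :> R)%R by rewrite ltr0n.
rewrite -ler_sqr ?nnegrE ?mulr_ge0 // -(ler_pM2r s0').
apply: le_trans h' _; rewrite exprMn mulrAC.
have -> : ((2 ^ s)%:R ^+ 2 = 4 ^+ s :> R)%R.
  by rewrite natrX exprAC -natrX.
by rewrite ler_peMl // exprn_ge0.
Qed.

(** * Sums of unit fractions *)

Section EgyptianFractions.
Variable R : realFieldType.
Local Open Scope ring_scope.

Lemma card_pi_le (I T : finType) (S : I -> {pred T}) (c : R) :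
  (forall i, #|S i|%:R <= c * #|T|%:R) ->
  #|[set A : {ffun I -> T} | [forall i, A i \in S i]]%SET|%:R
    <= c ^+ #|I| * #|{ffun I -> T}|%:R.
Proof.
move=> h.
have -> : #|[set A : {ffun I -> T} | [forall i, A i \in S i]]%SET|
    = (\sum_(A : {ffun I -> T}) \prod_i (A i \in S i : nat))%N.
  rewrite -sum1_card big_mkcond; apply: eq_bigr => A _; rewrite inE.
  case: forallP => [AS|nAS]; first by rewrite big1 // => i _; rewrite AS.
  case: (boolP [exists i, A i \notin S i]) => [/existsP[i /negbTE iS]|].
    by rewrite (bigD1 i) //= iS mul0n.
  by rewrite negb_exists => /forallP al; case: nAS => i; move: (al i); rewrite negbK.
rewrite -(bigA_distr_bigA (times := muln) (plus := addn) (fun i t => nat_of_bool (t \in S i))) /= natr_prod card_ffun natrX -exprMn.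
rewrite -[X in _ <= X]prodr_const; apply: ler_prod => i _.
rewrite ler0n /=; apply: le_trans (h i); rewrite ler_nat.
by rewrite -sum1_card [X in (_ <= X)%N]big_mkcond; apply: leq_sum => t _; case: ifP.
Qed.

(** After clearing all denominators, every term contains the factor [x i] except the one that comes
    from 1 / [x i]; so [x i] divides that one as well. *)
Lemma dvdn_prod_of_sum_inv_eq (k : nat) (x y : 'I_k -> nat) (i : 'I_k) :
  (forall j, 0 < x j)%N -> (forall j, 0 < y j)%N ->
  \sum_j (x j)%:R^-1 = \sum_j (y j)%:R^-1 :> R ->
  (x i %| (\prod_(j | j != i) x j) * \prod_j y j)%N.
Proof.
move=> x0 y0.
have clear (z : 'I_k -> nat) : (forall j, 0 < z j)%N ->
    (\sum_j (z j)%:R^-1) * (\prod_j z j)%:R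
    = (\sum_j \prod_(l | l != j) z l)%:R :> R.
  move=> z0; rewrite mulr_suml natr_sum; apply: eq_bigr => j _.
  by rewrite (bigD1 j) //= natrM mulKf // pnatr_eq0 -lt0n.
move=> /(congr1 (fun s => s * (\prod_j x j)%:R * (\prod_j y j)%:R)) /=.
rewrite clear // [RHS]mulrAC clear // -!natrM => /eqP; rewrite eqr_nat => /eqP.
set b := (\prod_j y j)%N.
rewrite (bigD1 i) //= mulnDl => E.
rewrite -(@dvdn_addl ((\sum_(j | j != i) \prod_(l | l != j) x l) * b)%N).
  by rewrite E dvdn_mull // (bigD1 i) //= dvdn_mulr.
rewrite dvdn_mulr // dvdn_sum // => j ji.
by rewrite (bigD1 i) 1?eq_sym //= dvdn_mulr.
Qed.

(** Iterates the fact that gcd(c, ab) divides gcd(c, a) gcd(c, b). *)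
Lemma leq_gcdn_prod (I : Type) (r : seq I) (P : pred I) (F : I -> nat) (c : nat) :
  (0 < c)%N -> (forall i, 0 < F i)%N ->
  (gcdn c (\prod_(i <- r | P i) F i) <= \prod_(i <- r | P i) gcdn c (F i))%N.
Proof.
move=> c0 F0; apply: dvdn_leq.
  by apply: prodn_gt0 => i; rewrite gcdn_gt0 c0.
elim: r => [|i r IH]; first by rewrite !big_nil gcdn1.
rewrite !big_cons; case: ifP => // _.
set a := F i; set b := (\prod_(j <- r | P j) F j)%N in IH *.
apply: dvdn_trans (dvdn_mul (dvdnn _) IH).
have -> : (gcdn c a * gcdn c b = gcdn (gcdn (c * c) (a * c)) (gcdn (c * b) (a * b)))%N.
  by rewrite muln_gcdr !muln_gcdl.
have h1 := dvdn_gcdl c (a * b); have h2 := dvdn_gcdr c (a * b).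
by rewrite !dvdn_gcd h2 (dvdn_mull c h1) (dvdn_mull a h1) (dvdn_mulr b h1).
Qed.

(** * One block of [k] independent random denominators *)

Section Block.
Variables (k : nat) (T : finType) (x : 'I_k -> T -> nat).
Variables (n Dl D : nat) (al be : R).
Hypothesis T_gt0 : (0 < #|T|)%N.
Hypothesis x_gt0 : forall i t, (0 < x i t)%N.
Hypothesis x_le : forall i t, (x i t <= n)%N.
Hypothesis divisors_le :
  forall c, (0 < c)%N -> (c <= n)%N -> (size (divisors c) <= Dl)%N.
Hypothesis D_gt1 : (1 < D)%N.
Hypothesis al_ge0 : 0 <= al.
Hypothesis be_ge0 : 0 <= be.
Hypothesis atom : forall i c, #|[set t | x i t == c]%SET|%:R <= al * #|T|%:R.
Hypothesis divisible :
  forall i g, (D <= g)%N -> #|[set t | (g %| x i t)%N]%SET|%:R <= be * #|T|%:R.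

Definition small_gcds (A : {ffun 'I_k -> T}) : bool :=
  [forall i, forall j, (i != j) ==> (gcdn (x i (A i)) (x j (A j)) < D)%N].

(** Union bound over the pairs (i, j) and, once the j-th denominator is frozen, over its at most
    [Dl] divisors: a large gcd is one of these, is at least [D], and divides the i-th denominator
    with probability at most [be]. *)
Lemma card_large_gcds :
  #|[set A | ~~ small_gcds A]%SET|%:R
    <= (k ^ 2 * Dl)%:R * be * #|{ffun 'I_k -> T}|%:R.
Proof.
rewrite cardsE.
pose C (p : 'I_k * 'I_k) := [pred A : {ffun 'I_k -> T} | (p.1 != p.2) &&
  (D <= gcdn (x p.1 (A p.1)) (x p.2 (A p.2)))%N].
have -> : (k ^ 2 * Dl)%:R * be = \sum_(p : 'I_k * 'I_k) (Dl%:R * be) :> R.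
  rewrite sumr_const card_prod card_ord -[RHS]mulr_natl mulrA -natrM.
  by rewrite -mulnn.
apply: (@card_le_disjunction R _ _ _ C).
  move=> A /=; rewrite negb_forall => /existsP[i].
  rewrite negb_forall => /existsP[j]; rewrite negb_imply -leqNgt => h.
  by exists (i, j).
move=> [i j]; rewrite /C /=.
apply: (@card_le_resample R _ _ i) => // A /=.
case: (eqVneq i j) => [_|ij] /=.
  by rewrite (eq_card0 (A := finset _)) ?mulr_ge0 // => t; rewrite inE.
set y := x j (A j).
have y0 : (0 < y)%N by apply: x_gt0.
apply: (@le_trans _ _ (\sum_(q < size (divisors y)) be * #|T|%:R)); last first.
  rewrite sumr_const card_ord -[X in X <= _]mulr_natl mulrA ler_wpM2r //.
  by rewrite ler_wpM2r // ler_nat divisors_le // x_le.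
rewrite -mulr_suml cardsE.
pose E (q : 'I_(size (divisors y))) := [pred t | (D <= nth 0 (divisors y) q)%N &&
  (nth 0 (divisors y) q %| x i t)%N].
apply: (@card_le_disjunction R _ _ _ E) => [t|q].
  rewrite !ffunE eqxx eq_sym (negbTE ij) -/y => Dg.
  have gy : gcdn (x i t) y \in divisors y by rewrite -dvdn_divisors // dvdn_gcdr.
  have lt_q : (index (gcdn (x i t) y) (divisors y) < size (divisors y))%N.
    by rewrite index_mem.
  by exists (Ordinal lt_q); apply/andP; rewrite nth_index // dvdn_gcdl.
rewrite /E; case: (leqP D (nth 0 (divisors y) q)) => Dq /=.
  have := divisible i Dq; rewrite cardsE; exact.
by rewrite (eq_card0 (A := [pred _ | _])) ?mulr_ge0 // => t; rewrite inE.
Qed.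

(** Relative to one fixed solution [A0], each denominator of any other solution lies in a set of at
    most ([Dl] [D])^k values that depends on [A0] only. Each value has probability at most [al], and
    the [k] coordinates are independent. *)
Lemma card_small_gcds_sum_inv (y : R) :
  #|[set A | small_gcds A && (\sum_i (x i (A i))%:R^-1 == y)]%SET|%:R
    <= (((Dl * D) ^ k)%:R * al) ^+ k * #|{ffun 'I_k -> T}|%:R.
Proof.
set S := finset _.
have [->|[A0 A0S]] := set_0Vmem S.
  by rewrite cards0 mulr_ge0 // exprn_ge0 // mulr_ge0.
pose b := (\prod_j x j (A0 j))%N.
have b0 : (0 < b)%N by apply: prodn_gt0.
have db : (size (divisors b) <= Dl ^ k)%N.
  rewrite -[k in (_ <= _ ^ k)%N]card_ord -prod_nat_const /b.
  suff [] : (0 < \prod_j x j (A0 j))%N /\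
    (size (divisors (\prod_j x j (A0 j))) <= \prod_(j < k) Dl)%N by [].
  elim/big_ind2 : _ => [|a1 c1 a2 c2 [a10 h1] [a20 h2]|j _] //.
    rewrite muln_gt0 a10; split => //.
    by apply: leq_trans (size_divisorsM _ _) _ => //; apply: leq_mul.
  by rewrite divisors_le ?x_gt0 ?x_le.
(* A pair [q] encodes a candidate value: a divisor of [b] times a cofactor below [D ^ k]. *)
pose F (q : 'I_(size (divisors b)) * 'I_(D ^ k)) i :=
  [set t | x i t == nth 0 (divisors b) q.1 * q.2]%SET.
apply: (@le_trans _ _ #|[set A : {ffun 'I_k -> T} | [forall i,
    A i \in [pred t | [exists q, t \in F q i]]]]%SET|%:R); last first.
  rewrite -[k in _ ^+ k]card_ord; apply: card_pi_le => i.
  apply: (@le_trans _ _ ((\sum_(q : 'I_(size (divisors b)) * 'I_(D ^ k)) al)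
     * #|T|%:R)).
    apply: (@card_le_disjunction R _ _ _ (fun q => [pred t | t \in F q i])).
      by move=> t /existsP.
    move=> q; exact: atom.
  rewrite ler_wpM2r // sumr_const card_prod !card_ord -[X in X <= _]mulr_natl.
  by rewrite ler_wpM2r // ler_nat expnMn leq_mul2r db orbT.
rewrite ler_nat; apply: subset_leq_card; apply/fintype.subsetP => A.
rewrite !inE => /andP[/forallP gA /eqP yA].
apply/forallP => i; rewrite inE; apply/existsP.
have yA0 : \sum_j (x j (A0 j))%:R^-1 = y.
  by move: A0S; rewrite inE => /andP[_ /eqP].
have := @dvdn_prod_of_sum_inv_eq k (fun j => x j (A j)) (fun j => x j (A0 j)) i.
rewrite yA yA0 -/b => /(_ (fun j => x_gt0 _ _) (fun j => x_gt0 _ _) erefl).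
set xi := x i (A i); set h := (\prod_(j | _) _)%N => xdvd.
have xi0 : (0 < xi)%N by apply: x_gt0.
set g := gcdn xi h.
have g0 : (0 < g)%N by rewrite gcdn_gt0 xi0.
(* [xi] divides [h * b]; removing [g], its gcd with [h], leaves a number coprime to [h %/ g], which
   therefore divides [b]. *)
have gb : (xi %/ g %| b)%N.
  have : coprime (xi %/ g) (h %/ g).
    rewrite /coprime -(eqn_pmul2l g0) muln_gcdr !(mulnC g).
    by rewrite !divnK ?dvdn_gcdl ?dvdn_gcdr // mul1n.
  move=> /Gauss_dvdr <-.
  rewrite -(dvdn_pmul2l g0) mulnA !(mulnC g).
  by rewrite !divnK ?dvdn_gcdl ?dvdn_gcdr.
(* [g] is at most the product of the k - 1 gcds of [xi] with the other denominators, all below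
   [D]. *)
have gD : (g < D ^ k)%N.
  apply: (@leq_ltn_trans (D ^ k.-1)).
    apply: leq_trans (leq_gcdn_prod _ _ _ _) _ => //.
    rewrite -[k.-1](_ : #|[pred j | j != i]| = _); last first.
      by rewrite -[k in RHS]card_ord -(cardC1 i); apply: eq_card.
    rewrite -prod_nat_const; apply: leq_prod => j ji; apply: ltnW.
    by have /forallP/(_ j)/implyP := gA i; apply; rewrite eq_sym.
  by rewrite ltn_exp2l // prednK // (leq_ltn_trans _ (ltn_ord i)).
have lt_q : (index (xi %/ g) (divisors b) < size (divisors b))%N.
  by rewrite index_mem -dvdn_divisors.
exists (Ordinal lt_q, Ordinal gD); rewrite inE; apply/eqP.
transitivity (xi %/ g * g)%N; first by rewrite divnK // dvdn_gcdl.
by rewrite /= nth_index // -dvdn_divisors.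
Qed.

End Block.

(** Either every block has a large gcd, which has the [K]-th power of a small probability by
    independence, or some block has small gcds. In the latter case, freezing the other blocks
    prescribes the sum over this block. *)
Lemma card_sum_inv_blocks (K k : nat) (T : finType)
    (x : 'I_K -> 'I_k -> T -> nat) (n Dl D : nat) (al be y : R) :
  (0 < #|T|)%N ->
  (forall r i t, 0 < x r i t)%N ->
  (forall r i t, x r i t <= n)%N ->
  (forall c, 0 < c -> c <= n -> size (divisors c) <= Dl)%N ->
  (1 < D)%N -> 0 <= al -> 0 <= be ->
  (forall r i c, #|[set t | x r i t == c]%SET|%:R <= al * #|T|%:R) ->
  (forall r i g, (D <= g)%N ->
     #|[set t | (g %| x r i t)%N]%SET|%:R <= be * #|T|%:R) ->
  #|[set A : {ffun 'I_K -> {ffun 'I_k -> T}} |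
       \sum_r \sum_i (x r i (A r i))%:R^-1 == y]%SET|%:R
    <= (((k ^ 2 * Dl)%:R * be) ^+ K + K%:R * (((Dl * D) ^ k)%:R * al) ^+ k)
       * #|{ffun 'I_K -> {ffun 'I_k -> T}}|%:R.
Proof.
move=> T0 x0 xn dl D1 al0 be0 atom dvd.
have Tk0 : (0 < #|{ffun 'I_k -> T}|)%N by rewrite card_ffun expn_gt0 T0.
pose c1 : R := ((k ^ 2 * Dl)%:R * be) ^+ K.
pose c2 : R := (((Dl * D) ^ k)%:R * al) ^+ k.
pose P (A : {ffun 'I_K -> {ffun 'I_k -> T}}) :=
  \sum_r \sum_i (x r i (A r i))%:R^-1 == y.
pose C (j : 'I_1 + 'I_K) : {pred {ffun 'I_K -> {ffun 'I_k -> T}}} := match j with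
  | inl _ => [pred A : {ffun _} | [forall r, A r \in [pred B | ~~ small_gcds (x r) D B]]]
  | inr r => [pred A : {ffun _} | small_gcds (x r) D (A r) && P A] end.
have -> : c1 + K%:R * c2 = \sum_(j : 'I_1 + 'I_K) (if j is inr _ then c2 else c1).
  by rewrite big_sumType /= big_ord1 sumr_const card_ord -[X in _ = _ + X]mulr_natl.
rewrite cardsE; apply: (@card_le_disjunction R _ _ _ C).
  move=> A /= PA; case: (boolP [exists r, small_gcds (x r) D (A r)]).
    by move=> /existsP[r rA]; exists (inr r); rewrite /C /= rA.
  by rewrite negb_exists => h; exists (inl ord0).
case=> [j|r]; rewrite /C {C} /=.
  have := @card_pi_le 'I_K _ (fun r => [pred B | ~~ small_gcds (x r) D B])
    ((k ^ 2 * Dl)%:R * be).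
  rewrite card_ord cardsE; apply=> r.
  have := @card_large_gcds k T (x r) n Dl D be T0 (x0 r) (xn r) dl be0 (dvd r).
  by rewrite cardsE.
apply: (@card_le_resample R _ _ r) => // A /=.
set s := \sum_(r' | r' != r) \sum_i (x r' i (A r' i))%:R^-1 : R.
have := @card_small_gcds_sum_inv k T (x r) n Dl D al (x0 r) (xn r) dl D1 al0
  (atom r) (y - s).
apply: le_trans; rewrite ler_nat; apply: subset_leq_card.
apply/fintype.subsetP => B; rewrite !inE !ffunE eqxx => /andP[-> /=].
rewrite /P (bigD1 r) //= => /eqP <-; apply/eqP.
have -> : \sum_(r' | r' != r) \sum_i (x r' i ([ffun j => if j == r then B
    else A j] r' i))%:R^-1 = s.
  by apply: eq_bigr => r' r'r; apply: eq_bigr => i _; rewrite ffunE (negbTE r'r).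
by rewrite addrK; apply: eq_bigr => i _; rewrite ffunE eqxx.
Qed.

End EgyptianFractions.

(** * Two-step return probabilities of a random graph *)

Section Flip.
Variable V : finType.
Implicit Types (G : sgraph V) (F : {set {set V}}) (u v w : V).

Lemma flip_subproof G F :
  [forall e in symd (val G) [set e in F | #|e| == 2]%SET, #|e| == 2].
Proof.
apply/forallP => e; apply/implyP; rewrite !inE.
have /forallP/(_ e)/implyP := valP G.
by case: (e \in val G) => //= [->|] // _; case/andP.
Qed.

(** Discarding the members of [F] that are not pairs makes the result a graph for every [F]. *)
Definition flip G F : sgraph V :=
  exist _ (symd (val G) [set e in F | #|e| == 2]%SET) (flip_subproof G F).

Lemma flipK F : involutive (fun G => flip G F).
Proof. by move=> G; apply: val_inj; rewrite /= symdK. Qed.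

Lemma adj_sym G u v : adj G u v = adj G v u.
Proof. by rewrite /adj finset.setUC. Qed.

Lemma adj_irr G u : adj G u u = false.
Proof.
apply/negP => uu; have /forallP/(_ _)/implyP/(_ uu) := valP G.
by rewrite finset.setUid cards1.
Qed.

Lemma adj_neq G u v : adj G u v -> u != v.
Proof. by apply: contraTneq => ->; rewrite adj_irr. Qed.

Lemma adj_flip G F u v :
  adj (flip G F) u v = adj G u v (+) (([set u; v]%SET \in F) && (u != v)).
Proof.
by rewrite /adj /= !inE cards2; case: (u != v).
Qed.

(** The flipped set may depend on the graph. The invariance hypothesis makes the flip an involution
    for each [x], hence measure preserving. *)
Lemma card_le_flip (R : realFieldType) (W : finType)
    (F : sgraph V -> W -> {set {set V}}) (B : {pred sgraph V}) (c : R) :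
  (0 < #|W|)%N ->
  (forall G (x : W), F (flip G (F G x)) x = F G x) ->
  (forall G, #|[set x | B (flip G (F G x))]|%SET%:R <= c * #|W|%:R)%R ->
  (#|B|%:R <= c * #|{: sgraph V}|%:R)%R.
Proof.
move=> W0 FF h.
apply: (card_le_average (psi := fun p => (flip p.1 (F p.1 p.2), p.2))) W0 h.
apply: (can_inj (g := fun p => (flip p.1 (F p.1 p.2), p.2))) => -[G w] /=.
by rewrite FF flipK.
Qed.

End Flip.

(* The two-step return probability of the simple random walk started at [u]. *)
Definition return2 (R : realFieldType) (V : finType) (G : sgraph V) (u : V) : R :=
  (#|neighbours G u|%:R^-1 *
   \sum_(w in neighbours G u) #|neighbours G w|%:R^-1)%R.

Section ReturnProbability.
Variables (R : realFieldType) (V : finType) (u : V) (K k : nat).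
Implicit Type G : sgraph V.
Local Open Scope ring_scope.

Definition far G : {set V} := (~: (u |: neighbours G u))%SET.

(** The default [u] occurs only when [u] has fewer than [K * k] neighbours. *)
Definition chosen G (p : 'I_K * 'I_k) : V :=
  nth u (enum (neighbours G u)) (enum_rank p).

(** The clause [u \notin e] excludes the edges that the default value of [chosen] would create. Thus
    a flip never changes the neighbourhood of [u], whatever its degree. *)
Definition crossing G (A : {ffun 'I_K -> {ffun 'I_k -> {set V}}}) : {set {set V}} :=
  [set e : {set V} | (u \notin e) && [exists p : 'I_K * 'I_k, exists v,
     (v \in A p.1 p.2 :&: far G) && (e == [set chosen G p; v])]]%SET.

Lemma neighbours_crossing G A :
  neighbours (flip G (crossing G A)) u = neighbours G u.
Proof.
apply/finset.setP => v; rewrite !inE adj_flip inE.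
by rewrite !inE eqxx /= addbF.
Qed.

Lemma far_crossing G A : far (flip G (crossing G A)) = far G.
Proof. by rewrite /far neighbours_crossing. Qed.

(** [crossing] depends on [G] only through the neighbourhood of [u]; this is the invariance that
    [card_le_flip] asks for. *)
Lemma crossing_flip G A : crossing (flip G (crossing G A)) A = crossing G A.
Proof. by rewrite {1}/crossing /far /chosen neighbours_crossing. Qed.

Section FixedGraph.
Variable G : sgraph V.
Hypothesis deg_u : (K * k <= #|neighbours G u|)%N.

Lemma chosen_neighbour p : chosen G p \in neighbours G u.
Proof.
rewrite -mem_enum mem_nth // -cardE (leq_trans _ deg_u) //.
by rewrite (leq_trans (ltn_ord _)) // card_prod !card_ord.
Qed.

Lemma chosen_inj : injective (chosen G).
Proof.
move=> p q /eqP; have h (r : 'I_K * 'I_k) : (enum_rank r < size (enum (neighbours G u)))%N.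
  by rewrite -cardE (leq_trans _ deg_u) // (leq_trans (ltn_ord _)) // card_prod !card_ord.
by rewrite nth_uniq ?enum_uniq // => /eqP /val_inj /enum_rank_inj.
Qed.

Lemma far_neighbour w : w \in neighbours G u -> w \notin far G.
Proof. by move=> wu; rewrite finset.in_setC finset.in_setU1 negbK wu orbT. Qed.

(** Chosen vertices are neighbours of [u], hence not in [far G]. So a crossing edge has exactly one
    chosen end, and each chosen vertex feels only its own set of [A]. *)
Lemma neighbours_chosen A (p : 'I_K * 'I_k) :
  neighbours (flip G (crossing G A)) (chosen G p) =
  symd (neighbours G (chosen G p)) (A p.1 p.2 :&: far G)%SET.
Proof.
have pu := chosen_neighbour p.
have pfar := far_neighbour pu.
apply/finset.setP => y; rewrite inE adj_flip [RHS]inE [in RHS]inE; congr (_ (+) _).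
rewrite inE; apply/idP/idP => [/andP[/andP[_]]|yA].
  case/existsP => q /existsP[v /andP[vA /eqP E]] py.
  have vfar : v \in far G by move: vA; rewrite inE => /andP[].
  have pq : chosen G p = chosen G q.
    have : chosen G p \in [set chosen G q; v]%SET by rewrite -E !inE eqxx.
    by rewrite !inE => /orP[/eqP //|/eqP vE]; rewrite vE vfar in pfar.
  have : y \in [set chosen G q; v]%SET by rewrite -E !inE eqxx orbT.
  rewrite !inE -pq eq_sym (negbTE py) /= => /eqP ->.
  by rewrite (chosen_inj pq); move: vA; rewrite !inE.
have yfar : y \in far G by move: yA; rewrite inE => /andP[].
have -> : chosen G p != y by apply: contraNneq pfar => ->.
rewrite andbT; apply/andP; split.
  rewrite !inE negb_or; apply/andP; split.
    by move: pu; rewrite inE => /adj_neq.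
  by move: yfar; rewrite !inE negb_or eq_sym => /andP[].
by apply/existsP; exists p; apply/existsP; exists y; rewrite yA eqxx.
Qed.

Lemma neighbours_unchosen A w : w \in neighbours G u ->
  w \notin (chosen G @: [set: 'I_K * 'I_k])%SET ->
  neighbours (flip G (crossing G A)) w = neighbours G w.
Proof.
move=> wu wc; have wfar := far_neighbour wu.
apply/finset.setP => y; rewrite !inE adj_flip.
case: (boolP ([set w; y]%SET \in _)) => [|_]; last by rewrite addbF.
rewrite inE => /andP[_ /existsP[q /existsP[v /andP[vA /eqP E]]]].
have : w \in [set chosen G q; v]%SET by rewrite -E !inE eqxx.
rewrite !inE => /orP[/eqP wE|/eqP wE].
  by case/negP: wc; rewrite wE imset_f // finset.in_setT.
by move: vA; rewrite inE -wE (negbTE wfar) andbF.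
Qed.

(** A function of the single set [t], so that the resampled degrees are independent. The fixed
    summand counts [u], which makes it positive. *)
Definition new_degree (r : 'I_K) (i : 'I_k) (t : {set V}) : nat :=
  (#|neighbours G (chosen G (r, i)) :\: far G|%SET +
   #|symd t (neighbours G (chosen G (r, i))) :&: far G|%SET)%N.

Lemma card_neighbours_chosen A (r : 'I_K) (i : 'I_k) :
  #|neighbours (flip G (crossing G A)) (chosen G (r, i))| = new_degree r i (A r i).
Proof.
rewrite neighbours_chosen /= -(cardsID (far G)) addnC; congr (_ + _)%N.
  by apply: eq_card => v; rewrite !inE; case: (_ || _); rewrite ?andbF ?addbF //= andbT.
by apply: eq_card => v; rewrite !inE; case: (_ || _); rewrite ?andbF //= !andbT addbC.
Qed.

Lemma new_degree_gt0 r i t : (0 < new_degree r i t)%N.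
Proof.
rewrite addn_gt0; apply/orP; left; apply/card_gt0P; exists u.
rewrite !inE eqxx /= adj_sym.
by have := chosen_neighbour (r, i); rewrite inE.
Qed.

Lemma new_degree_le r i t : (new_degree r i t <= #|V|)%N.
Proof.
rewrite /new_degree addnC -cardsUI (eq_card0 (A := (_ :&: _ :&: _)%SET)).
  by rewrite addn0 max_card.
by move=> v; rewrite !inE; case: (_ || _); rewrite ?andbF.
Qed.

Lemma return2_crossing A :
  return2 R (flip G (crossing G A)) u =
  #|neighbours G u|%:R^-1 *
    (\sum_r \sum_i (new_degree r i (A r i))%:R^-1 +
     \sum_(w in neighbours G u :\: chosen G @: [set: 'I_K * 'I_k])
       #|neighbours G w|%:R^-1).
Proof.
rewrite /return2 neighbours_crossing; congr (_ * _).
rewrite (big_setID (chosen G @: [set: 'I_K * 'I_k])%SET) /=; congr (_ + _).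
  have -> : (neighbours G u :&: chosen G @: [set: 'I_K * 'I_k])%SET
      = (chosen G @: [set: 'I_K * 'I_k])%SET.
    apply/finset.setIidPr/fintype.subsetP => _ /imsetP[p _ ->]; exact: chosen_neighbour.
  rewrite big_imset /=; last by move=> p q _ _; apply: chosen_inj.
  rewrite pair_big /=; apply: eq_big => [p|[r i] _]; first by rewrite finset.in_setT.
  by rewrite card_neighbours_chosen.
apply: eq_bigr => w; rewrite finset.in_setD => /andP[wc wu].
by rewrite neighbours_unchosen.
Qed.

End FixedGraph.

Lemma card_return2 (s Dl D : nat) (al be z : R) :
  (0 < K * k)%N -> (D <= s)%N -> (0 < D)%N ->
  (forall c, 0 < c -> c <= #|V| -> size (divisors c) <= Dl)%N ->
  0 <= al -> 0 <= be -> 1 <= al ^+ 2 * s%:R -> 1 <= be ^+ 2 * D%:R ->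
  #|[set G | [&& (K * k <= #|neighbours G u|)%N, (s <= #|far G|)%N
                 & return2 R G u == z]]%SET|%:R
   <= (((k ^ 2 * Dl)%:R * be) ^+ K + K%:R * (((Dl * D.+1) ^ k)%:R * al) ^+ k)
       * #|{: sgraph V}|%:R.
Proof.
move=> Kk0 Ds D0 dl al0 be0 als bes.
set c : R := _ + _.
have T0 : (0 < #|{ffun 'I_K -> {ffun 'I_k -> {set V}}}|)%N.
  by rewrite !card_ffun !expn_gt0 card_set_type expn_gt0.
rewrite cardsE; apply: (card_le_flip (F := crossing) T0) crossing_flip _ => G /=.
have c0 : 0 <= c.
  by rewrite addr_ge0 // ?exprn_ge0 ?mulr_ge0 ?exprn_ge0 ?mulr_ge0.
rewrite (@eq_card _ _ [set A | [&& (K * k <= #|neighbours G u|)%N,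
  (s <= #|far G|)%N & return2 R (flip G (crossing G A)) u == z]]%SET); last first.
  by move=> A; rewrite !inE neighbours_crossing far_crossing.
case: (leqP (K * k) #|neighbours G u|) => [degu|_] /=; last first.
  by rewrite (eq_card0 (A := finset _)) ?mulr_ge0 // => t; rewrite inE.
case: (leqP s #|far G|) => [degZ|_] /=; last first.
  by rewrite (eq_card0 (A := finset _)) ?mulr_ge0 // => t; rewrite inE.
set rest := \sum_(w in neighbours G u :\: chosen G @: [set: 'I_K * 'I_k])
  #|neighbours G w|%:R^-1 : R.
have degu0 : (0 < #|neighbours G u|)%N by apply: leq_trans degu.
set y := #|neighbours G u|%:R * z - rest.
apply: (@le_trans _ _ #|[set A : {ffun 'I_K -> {ffun 'I_k -> {set V}}} |
    \sum_r \sum_i (new_degree G r i (A r i))%:R^-1 == y]%SET|%:R); last first.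
  apply: (@card_sum_inv_blocks R K k _ (new_degree G) #|V|) => //.
  - by rewrite card_set_type expn_gt0.
  - exact: new_degree_gt0.
  - by move=> r i t; apply: new_degree_le.
  (* Atoms: a single value [j] is hit at most once among any s + 1 consecutive integers. *)
  - move=> r i j; apply: (card_anticoncentration _ _ (Q := pred1 j) degZ al0 als).
    by move=> a i1 i2 _ _ /eqP <- /eqP/addnI.
  move=> r i g Dg.
  (* Divisibility: only [D] of the edges are flipped here. Since [g] is at least [D.+1], at most one
     of D + 1 consecutive integers is a multiple of [g]; hence the threshold [D.+1] in the
     statement. *)
  apply: (card_anticoncentration _ _ (Q := dvdn g) (leq_trans Ds degZ) be0 bes).
  move=> a i1 i2; wlog le12 : i1 i2 / (i1 <= i2)%N => [H|].
    case: (leqP i1 i2) => [|/ltnW] h i1D i2D g1 g2; first exact: H.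
    by apply/esym/H.
  move=> i1D i2D g1 g2; have := dvdn_sub g2 g1; rewrite subnDl.
  case: (posnP (i2 - i1)) => [e _|i0 /(dvdn_leq i0)]; lia.
rewrite ler_nat; apply: subset_leq_card; apply/fintype.subsetP => A.
rewrite !inE return2_crossing // -/rest /y => /eqP <-.
by rewrite mulVKf ?addrK // pnatr_eq0 -lt0n.
Qed.

End ReturnProbability.

(** A set of at most [J] elements is listed by [J] slots, with [None] as padding. *)
Lemma card_small_sets (V : finType) (J : nat) :
  #|[set B : {set V} | #|B| <= J]%SET| <= #|V|.+1 ^ J.
Proof.
have -> : #|V|.+1 ^ J = #|{ffun 'I_J -> option V}| by rewrite card_ffun card_option card_ord.
pose f (g : {ffun 'I_J -> option V}) := [set x | Some x \in codom g]%SET.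
apply: leq_trans (leq_imset_card f _).
apply: subset_leq_card; apply/fintype.subsetP => B; rewrite inE => BJ.
apply/imsetP; exists [ffun j : 'I_J => nth None (map Some (enum B)) j] => //.
apply/finset.setP => x; rewrite inE -mem_enum; apply/idP/codomP => [xB|[j]].
  have ltJ : index x (enum B) < J by rewrite (leq_trans _ BJ) // cardE index_mem.
  exists (Ordinal ltJ); rewrite ffunE /= (nth_map x) ?index_mem //.
  by rewrite nth_index.
rewrite ffunE; case: (ltnP j (size (enum B))) => jB.
  by rewrite (nth_map x) // => -[->]; apply: mem_nth.
by rewrite nth_default // size_map.
Qed.

(** * Degrees and common neighbours in a uniform graph *)

Section Degrees.
Variables (R : realFieldType) (V : finType).
Implicit Types (G : sgraph V) (u v : V).
Local Open Scope ring_scope.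

Definition star (u : V) (A : {set V}) : {set {set V}} :=
  [set [set u; v] | v in A]%SET.

Lemma in_star u v w (A : {set V}) :
  ([set v; w]%SET \in star u A) =
  ((v == u) && (w \in A)) || ((w == u) && (v \in A)).
Proof.
apply/imsetP/orP => [[x xA E]|[]/andP[/eqP -> xA]]; last 2 first.
- by exists w.
- by exists v; rewrite // finset.setUC.
have vE : v \in [set u; x]%SET by rewrite -E !inE eqxx.
have wE : w \in [set u; x]%SET by rewrite -E !inE eqxx orbT.
have uE : u \in [set v; w]%SET by rewrite E !inE eqxx.
have xE : x \in [set v; w]%SET by rewrite E !inE eqxx orbT.
move: vE wE uE xE; rewrite !inE.
case: (eqVneq v u) => [->|vu] /=.
  case: (eqVneq w u) => [->|wu] /=; last by move=> _ /eqP-> _ _; left.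
  by move=> _ _ _; rewrite orbb => /eqP<-; left.
move=> /eqP vx; rewrite vx => /orP[/eqP->|/eqP->]; first by right; rewrite eqxx.
by rewrite !orbb => /eqP e; rewrite vx e eqxx in vu.
Qed.

Lemma neighbours_star G u A v : v != u ->
  (v \in neighbours (flip G (star u A)) u) = (v \in symd A (neighbours G u)).
Proof.
move=> vu; rewrite !inE adj_flip in_star eqxx (negbTE vu) /= orbF eq_sym vu andbT.
by rewrite addbC.
Qed.

Lemma card_symd_le (N : {set V}) (P : {pred {set V}}) :
  #|[set A | symd A N \in P]%SET| = #|P|.
Proof.
rewrite -(card_imset _ (can_inj (@symdK V N))); apply: eq_card => A.
apply/imsetP/idP => [[B]|AP]; first by rewrite inE => h ->.
by exists (symd A N); rewrite ?symdK // inE symdK.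
Qed.

(** Flipping a uniform star at [u] makes its neighbourhood a uniform set away from [u]. The exponent
    is [J.+1] because that uniform set may also contain [u]. *)
Lemma card_degree_le u J :
  #|[set G | (#|neighbours G u| <= J)%N]%SET|%:R
    <= (#|V|.+1 ^ J.+1)%:R / (2 ^ #|V|)%:R * #|{: sgraph V}|%:R :> R.
Proof.
rewrite cardsE; apply: (card_le_flip (F := fun=> star u)) => [|//|G].
  by rewrite card_set_type expn_gt0.
rewrite card_set_type divfK ?pnatr_eq0 -?lt0n ?expn_gt0 // ler_nat.
apply: leq_trans (card_small_sets V J.+1).
rewrite -[X in (_ <= X)%N](card_symd_le (neighbours G u)).
apply: subset_leq_card; apply/fintype.subsetP => A; rewrite !inE => AJ.
apply: (@leq_trans #|u |: neighbours (flip G (star u A)) u|%SET); last first.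
  by rewrite cardsU1 -add1n leq_add // leq_b1.
apply: subset_leq_card; apply/fintype.subsetP => v vA.
by rewrite finset.in_setU1; case: eqVneq => //= vu; rewrite neighbours_star.
Qed.

Lemma card_far_le u J :
  #|[set G | (#|far u G| <= J)%N]%SET|%:R
    <= (#|V|.+1 ^ J.+1)%:R / (2 ^ #|V|)%:R * #|{: sgraph V}|%:R :> R.
Proof.
rewrite cardsE; apply: (card_le_flip (F := fun=> star u)) => [|//|G].
  by rewrite card_set_type expn_gt0.
rewrite card_set_type divfK ?pnatr_eq0 -?lt0n ?expn_gt0 // ler_nat.
apply: leq_trans (card_small_sets V J.+1).
have -> : #|[set B : {set V} | (#|B| <= J.+1)%N]%SET| =
    #|[pred B : {set V} | (#|~: B|%SET <= J.+1)%N]|.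
  rewrite -(card_imset _ (can_inj (@finset.setCK V))); apply: eq_card => B.
  apply/imsetP/idP => [[C]|BJ]; first by rewrite !inE => h ->; rewrite finset.setCK.
  by exists (~: B)%SET; rewrite ?finset.setCK // inE.
rewrite -[X in (_ <= X)%N](card_symd_le (neighbours G u)).
apply: subset_leq_card; apply/fintype.subsetP => A; rewrite !inE => AJ.
apply: (@leq_trans #|u |: far u (flip G (star u A))|%SET); last first.
  by rewrite cardsU1 -add1n leq_add // leq_b1.
apply: subset_leq_card; apply/fintype.subsetP => v.
rewrite finset.in_setC finset.in_setU1; case: eqVneq => //= vu vA.
by rewrite finset.in_setC finset.in_setU1 (negbTE vu) /= neighbours_star.
Qed.

Definition common_neighbour G u v : bool :=
  [exists w, adj G u w && adj G w v].

(** With the neighbourhood of [v] frozen, that of [u] must avoid the at least [s] neighbours of [v]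
    other than [u]. *)
Lemma card_no_common_neighbour u v s : u != v ->
  #|[set G | [&& (s < #|neighbours G v|)%N, ~~ adj G u v
               & ~~ common_neighbour G u v]]%SET|%:R
    <= ((2 ^ s)%:R)^-1 * #|{: sgraph V}|%:R :> R.
Proof.
move=> uv; rewrite cardsE.
(* Removing [v] from the star leaves the edge between [u] and [v], and so all neighbours of [v],
   untouched. *)
apply: (card_le_flip (F := fun G A => star u (A :\ v)%SET)) => [|//|G].
  by rewrite card_set_type expn_gt0.
pose Z := (neighbours G v :\ u)%SET.
have nv A : neighbours (flip G (star u (A :\ v)%SET)) v = neighbours G v.
  apply/finset.setP => w; rewrite !inE adj_flip in_star !inE eqxx.
  by rewrite eq_sym (negbTE uv) /= andbF addbF.
case: (ltnP s #|neighbours G v|) => sG; last first.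
  rewrite (eq_card0 (A := finset _)) ?mulr_ge0 ?invr_ge0 // => A.
  by rewrite inE /= nv ltnNge sG.
have sZ : (s <= #|Z|)%N.
  by have := cardsD1 u (neighbours G v); rewrite -/Z; case: (u \in _); lia.
apply: (@le_trans _ _ #|powerset (~: Z)%SET|%:R).
  rewrite ler_nat -(cardsE (mem (powerset _))).
  rewrite -[X in (_ <= X)%N](card_symd_le (neighbours G u)).
  apply: subset_leq_card; apply/fintype.subsetP => A; rewrite !inE.
  move=> /and3P[_ nuv /existsPn ncom]; apply/fintype.subsetP => w wA.
  rewrite finset.in_setC; apply/negP => /setD1P[wu wv].
  have vw : v != w by move: wv; rewrite inE => /adj_neq.
  have := ncom w; rewrite (adj_sym _ w) => /negP; apply.
  have := nv A => /finset.setP/(_ w); rewrite !inE => ->.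
  move: wv; rewrite inE => ->; rewrite andbT.
  have := neighbours_star G (A :\ v)%SET wu; rewrite !inE => ->.
  by move: wA; rewrite !inE eq_sym vw.
rewrite card_powerset card_set_type mulrC ler_pdivlMr ?ltr0n ?expn_gt0 //.
rewrite -natrM -expnD ler_nat leq_exp2l // -(cardsC Z) addnC leq_add2r //.
Qed.

Lemma connected_of_common_neighbours G :
  (forall u v, u != v -> adj G u v || common_neighbour G u v) ->
  connected_graph G.
Proof.
move=> h u v; case: (eqVneq u v) => [->|/h]; first exact: connect0.
case/orP => [/connect1 //|/existsP[w /andP[uw wv]]].
exact: connect_trans (connect1 uw) (connect1 wv).
Qed.

End Degrees.

(** * Pairs of random graphs *)

Section PairsOfGraphs.
Variables (R : realFieldType) (V : finType).
Implicit Types (G : sgraph V) (p : sgraph V * sgraph V).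
Local Open Scope ring_scope.

Lemma card_le_pair (T : finType) (B : {pred T * T}) (c : R) :
  (0 < #|T|)%N ->
  (forall y, #|[set x | B (x, y)]%SET|%:R <= c * #|T|%:R) ->
  #|B|%:R <= c * #|{: T * T}|%:R.
Proof.
move=> T0 h.
pose psi (q : T * T * T) := ((q.2, q.1.2), q.1.1).
apply: (card_le_average (psi := psi)) => [|//|[x y]]; last exact: h.
by apply: (can_inj (g := psi)) => -[[x y] z].
Qed.

Lemma card_le_fst (T : finType) (P : {pred T}) (c : R) :
  (0 < #|T|)%N -> #|P|%:R <= c * #|T|%:R ->
  #|[pred q : T * T | P q.1]|%:R <= c * #|{: T * T}|%:R.
Proof.
move=> T0 h; apply: card_le_pair => // y; apply: le_trans h.
by rewrite ler_nat; apply: subset_leq_card; apply/fintype.subsetP => x; rewrite inE.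
Qed.

Lemma card_le_snd (T : finType) (P : {pred T}) (c : R) :
  (0 < #|T|)%N -> #|P|%:R <= c * #|T|%:R ->
  #|[pred q : T * T | P q.2]|%:R <= c * #|{: T * T}|%:R.
Proof.
move=> T0 h; apply: le_trans (card_le_fst T0 h).
have swapK : cancel (fun q : T * T => (q.2, q.1)) (fun q => (q.2, q.1)) by case.
rewrite ler_nat -(card_imset _ (can_inj swapK)).
apply: subset_leq_card; apply/fintype.subsetP => _ /imsetP[[x y] xP ->].
by move: xP; rewrite !inE.
Qed.

Lemma card_sgraph_gt0 : (0 < #|{: sgraph V}|)%N.
Proof.
have h : [forall e in (finset.set0 : {set {set V}}), #|e| == 2].
  by apply/forallP => e; rewrite inE.
by apply/card_gt0P; exists (exist _ finset.set0 h).
Qed.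

(** Diameter at most 2, a decidable condition that implies connectedness. *)
Definition all_close G : bool :=
  [forall u, forall v, (u != v) ==> (adj G u v || common_neighbour G u v)].

Lemma all_close_connected G : all_close G -> connected_graph G.
Proof.
move=> h; apply: connected_of_common_neighbours => u v.
by move/forallP/(_ u)/forallP/(_ v)/implyP: h; apply.
Qed.

Definition distinct_returns p : bool :=
  [&& all_close p.1, all_close p.2 &
      [forall u1, forall u2, return2 R p.1 u1 != return2 R p.2 u2]].

(** Union bound over three kinds of events: a small degree or co-degree in either graph, a pair
    without common neighbour in either graph, and a coincidence of return probabilities at a pair of
    roots. For a coincidence the second graph is frozen and provides the value [z] of
    [card_return2]. *)
Lemma card_not_distinct_returns (K k s Dl D : nat) (al be : R) :
  (0 < K * k)%N -> (D <= s)%N -> (0 < D)%N ->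
  (forall c, 0 < c -> c <= #|V| -> size (divisors c) <= Dl)%N ->
  0 <= al -> 0 <= be -> 1 <= al ^+ 2 * s%:R -> 1 <= be ^+ 2 * D%:R ->
  #|[set p | ~~ distinct_returns p]%SET|%:R <=
   ((4 * #|V|)%:R * ((#|V|.+1 ^ (s + K * k).+1)%:R / (2 ^ #|V|)%:R) +
    (2 * #|V| ^ 2)%:R * ((2 ^ s)%:R)^-1 +
    (#|V| ^ 2)%:R *
     (((k ^ 2 * Dl)%:R * be) ^+ K + K%:R * (((Dl * D.+1) ^ k)%:R * al) ^+ k))
   * #|{: sgraph V * sgraph V}|%:R.
Proof.
move=> Kk0 Ds D0 dl al0 be0 als bes.
set q : R := _ / _; set r : R := _^-1; set c : R := _ + K%:R * _.
have S0 := card_sgraph_gt0.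
pose J := (s + K * k)%N.
pose deg (u : V) (b : bool) : {pred sgraph V} := if b then [pred G | (#|neighbours G u| <= J)%N]
  else [pred G | (#|far u G| <= J)%N].
pose nocom (uv : V * V) : {pred sgraph V} := [pred G | [&& uv.1 != uv.2,
  (s < #|neighbours G uv.2|)%N, ~~ adj G uv.1 uv.2
               & ~~ common_neighbour G uv.1 uv.2]].
pose C (j : (bool * V * bool) + ((V * V * bool) + (V * V))) : {pred sgraph V * sgraph V} :=
  match j with
  | inl (b, u, b') => if b' then [pred p : sgraph V * sgraph V | deg u b p.1]
                      else [pred p : sgraph V * sgraph V | deg u b p.2]
  | inr (inl (uv, b')) => if b' then [pred p : sgraph V * sgraph V | nocom uv p.1]
                      else [pred p : sgraph V * sgraph V | nocom uv p.2]
  | inr (inr (u1, u2)) => [pred p : sgraph V * sgraph V |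
      [&& (K * k <= #|neighbours p.1 u1|)%N, (s <= #|far u1 p.1|)%N
        & return2 R p.1 u1 == return2 R p.2 u2]]
  end.
have -> : (4 * #|V|)%:R * q + (2 * #|V| ^ 2)%:R * r + (#|V| ^ 2)%:R * c =
    \sum_(j : (bool * V * bool) + ((V * V * bool) + (V * V)))
      match j with inl _ => q | inr (inl _) => r | inr (inr _) => c end.
  rewrite !big_sumType /= !sumr_const !card_prod !card_bool -addrA.
  rewrite -[q *+ _]mulr_natl -[r *+ _]mulr_natl -[c *+ _]mulr_natl.
  by congr (_%:R * _ + (_%:R * _ + _%:R * _)); rewrite -?mulnn; [rewrite mulnAC|rewrite mulnC].
rewrite cardsE; apply: (@card_le_disjunction R _ _ _ C); last first.
  case=> [[[b u] b']|[[[u v] b']|[u1 u2]]]; rewrite /C {C}.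
  - have h : #|deg u b|%:R <= q * #|{: sgraph V}|%:R.
      rewrite /deg; case: b; rewrite -cardsE;
      [exact: card_degree_le|exact: card_far_le].
    by case: b'; [apply: card_le_fst|apply: card_le_snd].
  - have h : #|nocom (u, v)|%:R <= r * #|{: sgraph V}|%:R.
      rewrite /nocom /=; case: (eqVneq u v) => [_|uv] /=.
        by rewrite eq_card0 ?mulr_ge0 ?invr_ge0 // => G; rewrite inE.
      by rewrite -cardsE; apply: card_no_common_neighbour.
    by case: b'; [apply: card_le_fst|apply: card_le_snd].
  - by apply: card_le_pair => // G2 /=; apply: card_return2.
case=> G1 G2; rewrite /distinct_returns /=.
have sJ : (s <= J)%N by apply: leq_addr.
have KJ : (K * k <= J)%N by apply: leq_addl.
pose degs G := [forall u, (J < #|neighbours G u|) && (J < #|far u G|)]%N.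
have degsN G : ~~ degs G -> exists u b, deg u b G.
  rewrite negb_forall => /existsP[u]; rewrite negb_and -!leqNgt.
  by case/orP => h; exists u; [exists true|exists false].
case: (boolP (degs G1)) => [/forallP d1 sep|/degsN[u [b h]] _]; last first.
  by exists (inl (b, u, true)).
case: (boolP (degs G2)) sep => [/forallP d2 sep|/degsN[u [b h]] _]; last first.
  by exists (inl (b, u, false)).
have closeN G : degs G -> ~~ all_close G -> exists uv, nocom uv G.
  move=> /forallP d; rewrite negb_forall => /existsP[u].
  rewrite negb_forall => /existsP[v]; rewrite negb_imply negb_or.
  case/and3P => uv nadj ncom; exists (u, v); rewrite /nocom /= uv nadj ncom.
  by have /andP[/(leq_ltn_trans sJ) -> _] := d v.
move: sep; rewrite !negb_and => /or3P[].
- move=> /(closeN _ _)[|uv h]; first exact/forallP.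
  by exists (inr (inl (uv, true))).
- move=> /(closeN _ _)[|uv h]; first exact/forallP.
  by exists (inr (inl (uv, false))).
rewrite negb_forall => /existsP[u1]; rewrite negb_forall => /existsP[u2].
rewrite negbK => e; exists (inr (inr (u1, u2))); rewrite /C /= e.
have /andP[h1 h2] := d1 u1.
by rewrite (leq_trans KJ (ltnW h1)) (leq_trans sJ (ltnW h2)).
Qed.

End PairsOfGraphs.

(** * Choice of the parameters and asymptotics *)

Lemma floor_root (E n : nat) : 0 < E -> exists2 t, t ^ E <= n & n < t.+1 ^ E.
Proof.
move=> E0; elim: n => [|n [t tn nt]]; first by exists 0; rewrite ?exp0n ?exp1n.
have [h|h] := ltnP n.+1 (t.+1 ^ E); first by exists t => //; apply: leqW.
exists t.+1 => //; apply: leq_ltn_trans nt _; by rewrite ltn_exp2r.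
Qed.

(** With x = t^e, [n] is at least x^4 while n + 1 <= 2^(5x), so everything reduces to polynomial
    inequalities in x. *)
Lemma exp2_dominates (e t n m : nat) : 0 < e -> 16 <= t -> m + 3 <= t ->
  t ^ (4 * e) <= n -> n < t.+1 ^ (4 * e) ->
  [/\ t <= n, n.+1 ^ 3 <= 2 ^ (t ^ (2 * e)) &
      n.+1 ^ (t ^ (2 * e) + m + 3) <= 2 ^ n].
Proof.
move=> e0 t16 mt tn nt.
have t0 : 0 < t by apply: leq_trans t16.
have ht a b : a <= b -> t ^ a <= t ^ b by move=> ab; apply: leq_pexp2l.
have x16 : 16 <= t ^ e by rewrite (leq_trans t16) // -{1}(expn1 t) ht.
have n1 : n.+1 <= 2 ^ (5 * t ^ e).
  apply: (leq_trans nt); apply: (@leq_trans (t ^ (5 * e))).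
    have -> : 5 * e = e + 4 * e by lia.
    rewrite expnD; apply: (@leq_trans ((2 * t) ^ (4 * e))).
      by rewrite leq_exp2r ?muln_gt0 //; lia.
    by rewrite expnMn leq_mul2r (expnM 2) leq_exp2r // t16 orbT.
  by rewrite mulnC expnM mulnC expnM leq_exp2r // ltnW // ltn_expl.
have e2 : t ^ (2 * e) = t ^ e * t ^ e by rewrite -expnD addnn mul2n.
have e4 : t ^ (4 * e) = t ^ e * t ^ e * (t ^ e * t ^ e).
  by rewrite -!expnD; congr (_ ^ _); lia.
split.
- by apply: leq_trans tn; rewrite -{1}(expn1 t) ht //; lia.
- apply: (@leq_trans ((2 ^ (5 * t ^ e)) ^ 3)); first by rewrite leq_exp2r.
  by rewrite -expnM leq_exp2l // e2; nia.
- apply: (@leq_trans ((2 ^ (5 * t ^ e)) ^ (t ^ (2 * e) + m + 3))).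
    by rewrite leq_exp2r // addn3.
  rewrite -expnM leq_exp2l // (leq_trans _ tn) // e2 e4.
  have : m + 3 <= t ^ e by rewrite (leq_trans mt) // -{1}(expn1 t) ht.
  move: (t ^ e) x16 => x x16 mx.
  apply: (@leq_trans (5 * x * (x * x + x))); first by rewrite leq_mul2l; lia.
  rewrite -mulnA; nia.
Qed.

Section Asymptotics.
Variable R : archiRealFieldType.
Local Open Scope ring_scope.

(** All parameters are powers of [t], roughly n^(1/(4e)), up to constants: s = t^(2e), D = t^4, al =
    t^(-e), be = t^(-2) and Dl = 2Ct. As n^2 is of order t^(8e), the choice K = 8e + 1 makes the
    first block term O(1/t). The second is of order t^(8e + 5k^2 - ek), which is why [ek] is
    assumed. *)
Lemma card_not_distinct_returns_root (k e C t : nat) (V : finType) :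
  (0 < e)%N -> (0 < k)%N -> (8 * e + 1 + 5 * k ^ 2 <= e * k)%N ->
  (forall x, 0 < x -> size (divisors x) ^ (4 * e) <= C * x)%N -> (0 < C)%N ->
  (16 <= t)%N -> ((8 * e).+1 * k + 3 <= t)%N ->
  (t ^ (4 * e) <= #|V|)%N -> (#|V| < t.+1 ^ (4 * e))%N ->
  #|[set p : sgraph V * sgraph V | ~~ distinct_returns R p]%SET|%:R <=
    (6 + 2 ^+ (8 * e) * ((k ^ 2 * (2 * C))%:R ^+ (8 * e).+1 +
        (8 * e).+1%:R * (4 * C)%:R ^+ (k * k))) * t%:R^-1
    * #|{: sgraph V * sgraph V}|%:R :> R.
Proof.
move=> e0 k0 ek divC C0 t16 mt tn nt.
set n := #|V| in tn nt *; set K := (8 * e).+1.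
have [t_n n3 nJ] := exp2_dominates e0 t16 mt tn nt.
have t0 : (0 < t)%N by apply: leq_trans t16.
have tR0 : 0 < t%:R :> R by rewrite ltr0n.
set tau : R := t%:R^-1.
have tau0 : 0 <= tau by rewrite invr_ge0 ler0n.
have ttau : t%:R * tau = 1 by rewrite mulfV // gt_eqF.
have tau1 : tau <= 1 by rewrite invf_le1 // ler1n.
have n2t : (n <= (2 * t) ^ (4 * e))%N.
  by apply: leq_trans (ltnW nt) _; rewrite leq_exp2r ?muln_gt0 //; lia.
have divs c : (0 < c -> c <= n -> size (divisors c) <= 2 * C * t)%N.
  move=> c0 cn; rewrite -(@leq_exp2r _ _ (4 * e)) ?muln_gt0 //.
  apply: leq_trans (divC _ c0) _.
  rewrite (_ : 2 * C * t = C * (2 * t))%N; last by lia.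
  rewrite expnMn; apply: leq_mul; last exact: leq_trans n2t.
  by rewrite -{1}(expn1 C); apply: leq_pexp2l; lia.
have pw a : t%:R ^+ a * tau ^+ a = 1 by rewrite -exprMn ttau expr1n.
have pw_le a b : (a < b)%N -> t%:R ^+ a * tau ^+ b <= tau.
  move=> ab; rewrite -(subnKC ab) exprD exprSr mulrA mulrA pw mul1r.
  by rewrite ler_piMr // exprn_ile1.
have Dle : (t ^ 4 <= t ^ (2 * e))%N by rewrite leq_pexp2l //; nia.
have hal : 1 <= (tau ^+ e) ^+ 2 * (t ^ (2 * e))%:R.
  by rewrite -exprM natrX (mulnC e) mulrC pw.
have hbe : 1 <= (tau ^+ 2) ^+ 2 * (t ^ 4)%:R by rewrite -exprM natrX mulrC pw.
have Kk : (0 < K * k)%N by rewrite muln_gt0 k0.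
have D0 : (0 < t ^ 4)%N by rewrite expn_gt0 t0.
apply: le_trans (card_not_distinct_returns Kk Dle D0 divs _ _ hal hbe) _.
- by rewrite exprn_ge0.
- by rewrite exprn_ge0.
rewrite ler_wpM2r // -/n mulrDl; apply: lerD.
  have -> : 6 = 4 + 2 :> R by rewrite -natrD.
  rewrite mulrDl; apply: lerD.
    rewrite natrM -mulrA; apply: ler_wpM2l => //.
    rewrite mulrA ler_pdivrMr ?ltr0n ?expn_gt0 // ler_pdivlMl //.
    rewrite -!natrM ler_nat; apply: leq_trans nJ.
    rewrite addn3 2!(expnS n.+1 _.+1).
    by apply: leq_mul; [exact: leqW|apply: leq_mul].
  rewrite natrM -mulrA; apply: ler_wpM2l => //.
  rewrite ler_pdivrMr ?ltr0n ?expn_gt0 // ler_pdivlMl //.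
  rewrite -!natrM ler_nat; apply: leq_trans n3.
  by rewrite (expnS n.+1 2); apply: leq_mul; [exact: leqW|rewrite leq_exp2r].
apply: (@le_trans _ _ (2 ^+ (8 * e) * (t%:R ^+ (8 * e) *
   (((k ^ 2 * (2 * C * t))%:R * tau ^+ 2) ^+ K +
    K%:R * (((2 * C * t * (t ^ 4).+1) ^ k)%:R * tau ^+ e) ^+ k)))).
  rewrite mulrA ler_wpM2r //.
    by rewrite addr_ge0 ?exprn_ge0 ?mulr_ge0 ?exprn_ge0 ?mulr_ge0 ?exprn_ge0.
  rewrite -exprMn -natrM -natrX ler_nat.
  have -> : (8 * e = 4 * e * 2)%N by lia.
  by rewrite expnM leq_exp2r.
rewrite -mulrA; apply: ler_wpM2l; first by rewrite exprn_ge0.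
rewrite mulrDr mulrDl; apply: lerD.
  have -> : (k ^ 2 * (2 * C * t))%:R * tau ^+ 2 = (k ^ 2 * (2 * C))%:R * tau :> R.
    by rewrite mulnA natrM -mulrA expr2 (mulrA t%:R) ttau mul1r.
  rewrite exprMn mulrCA; apply: ler_wpM2l; first by rewrite exprn_ge0.
  exact: pw_le.
rewrite mulrCA -mulrA; apply: ler_wpM2l => //.
apply: (@le_trans _ _ (t%:R ^+ (8 * e) *
   ((4 * C)%:R ^+ (k * k) * (t%:R ^+ (5 * k ^ 2) * tau ^+ (e * k))))).
  apply: ler_wpM2l; first by rewrite exprn_ge0.
  rewrite exprMn -exprM mulrA ler_wpM2r ?exprn_ge0 //.
  rewrite -!natrX -natrM ler_nat -expnM.
  have -> : (5 * k ^ 2 = 5 * (k * k))%N by [].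
  rewrite (expnM t 5) -expnMn leq_exp2r ?muln_gt0 ?k0 //.
  have : (0 < t ^ 4)%N by [].
  rewrite (expnS t 4); nia.
rewrite mulrCA; apply: ler_wpM2l; first by rewrite exprn_ge0.
rewrite mulrA -exprD; apply: pw_le; lia.
Qed.

Lemma card_not_distinct_returns_small (eps : R) : 0 < eps ->
  exists N, forall V : finType, (N <= #|V|)%N ->
    #|[set p : sgraph V * sgraph V | ~~ distinct_returns R p]%SET|%:R <=
      eps * #|{: sgraph V * sgraph V}|%:R.
Proof.
move=> eps0.
have [e [k [e0 k0 ek]]] : exists e k,
    [/\ 0 < e, 0 < k & 8 * e + 1 + 5 * k ^ 2 <= e * k]%N.
  (* For k = 10 the condition reads 8e + 501 <= 10e, that is e >= 251. *)
  by exists 300%N, 10%N.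
have [|C C0 divC] := @size_divisors_bound (4 * e); first by rewrite muln_gt0.
have {}divC x : (0 < x -> size (divisors x) ^ (4 * e) <= C * x)%N := divC x.
set M : R := 6 + 2 ^+ (8 * e) * ((k ^ 2 * (2 * C))%:R ^+ (8 * e).+1 +
        (8 * e).+1%:R * (4 * C)%:R ^+ (k * k)).
have M0 : 0 <= M.
  by rewrite !(addr_ge0, mulr_ge0, exprn_ge0).
pose t0 := (16 + ((8 * e).+1 * k + 3) + Num.truncn (M / eps))%N.
exists (t0 ^ (4 * e))%N => V nV.
have [|t tn nt] := @floor_root (4 * e) #|V|; first by rewrite muln_gt0.
have tt0 : (t0 <= t)%N.
  by have := leq_ltn_trans nV nt; rewrite ltn_exp2r ?muln_gt0.
apply: le_trans (@card_not_distinct_returns_root k e C t V e0 k0 ek _ C0 _ _ tn nt) _.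
- exact: divC.
- by apply: leq_trans tt0; rewrite /t0; lia.
- by apply: leq_trans tt0; rewrite /t0; lia.
rewrite ler_wpM2r // -/M ler_pdivrMr; last first.
  by rewrite ltr0n (leq_trans _ tt0).
rewrite mulrC -ler_pdivrMr //; apply: le_trans (ltW (truncnS_gt _)) _.
by rewrite ler_nat; apply: leq_trans tt0; rewrite /t0 -add1n leq_add2r.
Qed.

End Asymptotics.

(** * The limiting correlations as rational functions *)

Local Open Scope ring_scope.


(** Cramer's rule for (1 - aM) N = D r, where M is the kernel of two independent walks killed on the
    diagonal and r is the indicator of the diagonal: D = det(1 - aM) and N = adj(1 - aM) r are
    polynomials in a. For stochastic [p] and 0 <= a < 1, the quotient N / D is the generating
    function of the meeting time. *)
Lemma rational_meeting_function (R : fieldType) (V : finType) (p : V -> V -> R) :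
  exists (D : {poly R}) (N : V -> V -> {poly R}),
    [/\ D.[0] = 1, forall v w, (N v w).[0] = (v == w)%:R &
     forall a v w, (N v w).[a] = if v == w then D.[a] else
       a * \sum_v' \sum_w' p v v' * p w w' * (N v' w').[a]].
Proof.
pose I := #|{: V * V}|.
pose M : 'M[R]_I := \matrix_(i, j)
  (let vw := enum_val i in let vw' := enum_val j in
   if vw.1 == vw.2 then 0 else p vw.1 vw'.1 * p vw.2 vw'.2).
pose A : 'M[{poly R}]_I := 1%:M - 'X *: map_mx polyC M.
pose r : 'cV[{poly R}]_I := \col_i ((enum_val i).1 == (enum_val i).2)%:R.
have A0 : map_mx (horner_eval 0) A = 1%:M.
  apply/matrixP => i j; rewrite !mxE /horner_eval hornerD hornerN hornerM hornerX mul0r.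
  by rewrite subr0 hornerMn hornerC.
have D0 : (\det A).[0] = 1.
  by rewrite -[LHS]/(horner_eval 0 (\det A)) -det_map_mx A0 det1.
have [N AN] : exists N, A *m N = \det A *: r.
  by exists (\adj A *m r); rewrite mulmxA mul_mx_adj mul_scalar_mx.
move: (\det A) D0 AN => D D0 AN.
have NE i : N i 0 = D * r i 0 + 'X * \sum_j (M i j)%:P * N j 0.
  move/matrixP/(_ i 0): AN; rewrite mulmxBl mul1mx -scalemxAl !mxE => <-.
  rewrite [X in _ - X + _](_ : _ = 'X * \sum_j (M i j)%:P * N j 0) ?subrK //.
  by congr (_ * _); apply: eq_bigr => j _; rewrite mxE.
exists D, (fun v w => N (enum_rank (v, w)) 0); split => //.
  move=> v w; rewrite NE mxE enum_rankK /= hornerD !hornerM hornerX mul0r addr0.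
  by rewrite D0 mul1r hornerMn hornerC.
move=> a v w; rewrite {1}NE mxE enum_rankK /= hornerD !hornerM hornerX.
rewrite horner_sum hornerMn hornerC.
case: (eqVneq v w) => [vw|vw] /=.
  rewrite mulr1 big1 ?mulr0 ?addr0 // => j _.
  by rewrite mxE enum_rankK /= vw eqxx hornerM hornerC mul0r.
rewrite mulr0 add0r pair_big /=; congr (_ * _).
rewrite (reindex (@enum_rank _)) /=; last by apply: onW_bij; apply: enum_rank_bij.
apply: eq_bigr => -[v' w'] _; rewrite mxE !enum_rankK /= (negbTE vw).
by rewrite hornerM hornerC.
Qed.

(** * Duality for the noisy voter model *)

Section FiniteModel.
Variables (R : realType) (V : finType) (G : sgraph V) (eps : R).
Hypothesis eps01 : 0 < eps < 1.
Hypothesis deg_gt0 : forall u, (0 < #|neighbours G u|)%N.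

Definition state := {ffun V -> bool}.
Definition noise := {ffun V -> bool * bool * V}.
Definition spin (b : bool) : R := if b then 1 else -1.

(** [y] holds the values of xi, Y and eta at [u]. The membership test mirrors the recursion, whose
    sum over neighbours is 0 when eta is not a neighbour. *)
Definition site_update (u : V) (y : bool * bool * V) (x : state) : bool :=
  if y.1.1 then y.1.2 else (y.2 \in neighbours G u) && x y.2.

Definition update (x : state) (z : noise) : state :=
  [ffun u => site_update u (z u) x].

Definition walk (u v : V) : R := uniform_pmf R (neighbours G u) v.

Definition site_weight (u : V) (y : bool * bool * V) : R :=
  bernoulli_pmf eps y.1.1 * bernoulli_pmf 2^-1 y.1.2 * walk u y.2.

Definition noise_weight (z : noise) : R := \prod_u site_weight u (z u).

Lemma walk_ge0 u v : 0 <= walk u v.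
Proof. by rewrite /walk /uniform_pmf; case: ifP. Qed.

Lemma sum_walk (f : V -> R) u :
  \sum_v walk u v * f v = #|neighbours G u|%:R^-1 * \sum_(v in neighbours G u) f v.
Proof.
rewrite mulr_sumr [RHS]big_mkcond; apply: eq_bigr => v _.
by rewrite /walk /uniform_pmf; case: ifP => // _; rewrite mul0r.
Qed.

Lemma sum_walk1 u : \sum_v walk u v = 1.
Proof.
under eq_bigr do rewrite -[walk _ _]mulr1.
by rewrite sum_walk sumr_const mulVf // pnatr_eq0 -lt0n.
Qed.

Lemma sum_site_weight u (f : bool * bool * V -> R) :
  \sum_y site_weight u y * f y =
  \sum_v walk u v * (eps * (2^-1 * f (true, true, v) + 2^-1 * f (true, false, v))
   + (1 - eps) * (2^-1 * f (false, true, v) + 2^-1 * f (false, false, v))).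
Proof.
transitivity (\sum_(b : bool) \sum_(b' : bool) \sum_v
    site_weight u (b, b', v) * f (b, b', v)).
  by rewrite pair_bigA pair_bigA; apply: eq_bigr => -[[b b'] v].
under eq_bigr do rewrite exchange_big /=.
rewrite exchange_big /=; apply: eq_bigr => v _.
rewrite !big_bool /= /site_weight /= /bernoulli_pmf /=.
have -> : 1 - 2^-1 = 2^-1 :> R by lra.
ring.
Qed.

Lemma site_weight_ge0 u y : 0 <= site_weight u y.
Proof.
have [h1 h2] := andP eps01.
by rewrite /site_weight !mulr_ge0 ?walk_ge0 // /bernoulli_pmf; case: ifP => _; lra.
Qed.

Lemma sum_site_weight1 u : \sum_y site_weight u y = 1.
Proof.
under eq_bigr do rewrite -[site_weight _ _]mulr1.
rewrite sum_site_weight -[RHS](sum_walk1 u); apply: eq_bigr => v _.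
by rewrite !mulr1; field.
Qed.

Lemma sum_noise_weight_prod (g : V -> bool * bool * V -> R) :
  \sum_z noise_weight z * \prod_u g u (z u) = \prod_u \sum_y site_weight u y * g u y.
Proof.
rewrite bigA_distr_bigA /=; apply: eq_bigr => z _.
by rewrite -big_split.
Qed.

Lemma sum_noise_weight1 : \sum_z noise_weight z = 1.
Proof.
transitivity (\sum_z noise_weight z * \prod_(u : V) 1).
  by apply: eq_bigr => z _; rewrite big1 // mulr1.
rewrite (sum_noise_weight_prod (fun _ _ => 1)) big1 // => u _.
by under eq_bigr do rewrite mulr1; rewrite sum_site_weight1.
Qed.

Lemma noise_weight_ge0 z : 0 <= noise_weight z.
Proof. by apply: prodr_ge0 => u _; apply: site_weight_ge0. Qed.

Lemma sum_noise_weight_site u (g : bool * bool * V -> R) :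
  \sum_z noise_weight z * g (z u) = \sum_y site_weight u y * g y.
Proof.
pose h v y := if v == u then g y else 1.
transitivity (\sum_z noise_weight z * \prod_v h v (z v)).
  apply: eq_bigr => z _; rewrite (bigD1 u) //= /h eqxx big1 ?mulr1 // => v /negbTE -> //.
rewrite sum_noise_weight_prod (bigD1 u) //= /h eqxx [X in _ * X]big1 ?mulr1 // => v /negbTE ->.
by under eq_bigr do rewrite mulr1; rewrite sum_site_weight1.
Qed.

Lemma sum_noise_weight_sites u v (g h : bool * bool * V -> R) : u != v ->
  \sum_z noise_weight z * (g (z u) * h (z v)) =
  (\sum_y site_weight u y * g y) * (\sum_y site_weight v y * h y).
Proof.
move=> uv; have vu : v != u by rewrite eq_sym.
pose f w y := if w == u then g y else if w == v then h y else 1.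
transitivity (\sum_z noise_weight z * \prod_v f v (z v)).
  apply: eq_bigr => z _; congr (_ * _).
  rewrite (bigD1 u) //= (bigD1 v) //= /f !eqxx (negbTE vu) big1 ?mulr1 //.
  by move=> w /andP[/negbTE -> /negbTE ->].
rewrite sum_noise_weight_prod (bigD1 u) //= (bigD1 v) //= /f !eqxx (negbTE vu).
rewrite [X in _ * (_ * X)]big1 ?mulr1 // => w /andP[/negbTE -> /negbTE ->].
by under eq_bigr do rewrite mulr1; rewrite sum_site_weight1.
Qed.

Lemma sum_site_weight_spin u (x : state) :
  \sum_y site_weight u y * spin (site_update u y x) =
  (1 - eps) * \sum_v walk u v * spin (x v).
Proof.
rewrite sum_site_weight mulr_sumr; apply: eq_bigr => v _.
rewrite /site_update /= /walk /uniform_pmf; case: ifP => _ /=; last by rewrite !mul0r mulr0.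
rewrite /spin; case: (x v); field; by rewrite pnatr_eq0 -lt0n.
Qed.

(** The one-step Markov operator: [iter n transfer f x] is the expectation of [f] after n steps
    started from [x]. *)
Definition transfer (f : state -> R) (x : state) : R :=
  \sum_z noise_weight z * f (update x z).

Lemma transfer_sum (I : finType) (c : I -> R) (f : I -> state -> R) :
  transfer (fun x => \sum_i c i * f i x) = (fun x => \sum_i c i * transfer (f i) x).
Proof.
apply/funext => x; rewrite /transfer; under eq_bigr do rewrite mulr_sumr.
rewrite exchange_big /=; apply: eq_bigr => i _; rewrite mulr_sumr.
by apply: eq_bigr => z _; rewrite mulrCA.
Qed.

Lemma iter_transfer_sum n (I : finType) (c : I -> R) (f : I -> state -> R) :
  iter n transfer (fun x => \sum_i c i * f i x) =
  (fun x => \sum_i c i * iter n transfer (f i) x).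
Proof. by elim: n => //= n ->; rewrite transfer_sum. Qed.

Lemma transfer_spin u x :
  transfer (fun x => spin (x u)) x = (1 - eps) * \sum_v walk u v * spin (x v).
Proof.
rewrite /transfer -sum_site_weight_spin.
rewrite -(sum_noise_weight_site u (fun y => spin (site_update u y x))).
by apply: eq_bigr => z _; rewrite ffunE.
Qed.

Lemma spin_sqr b : spin b * spin b = 1.
Proof. by rewrite /spin; case: b; lra. Qed.

Definition decay : R := (1 - eps) ^+ 2.

Lemma decay_bounds : 0 < decay < 1.
Proof. rewrite /decay; move: eps01 => /andP[h1 h2]; apply/andP; split; nra. Qed.

(** At distinct vertices the updates are independent, and each spin is copied with probability 1 -
    eps and otherwise has mean 0. *)
Lemma transfer_spins u v x :
  transfer (fun x => spin (x u) * spin (x v)) x =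
  if u == v then 1 else
  decay * \sum_u' \sum_v' walk u u' * walk v v' * (spin (x u') * spin (x v')).
Proof.
rewrite /transfer; case: (eqVneq u v) => [<-|uv].
  under eq_bigr do rewrite spin_sqr mulr1.
  exact: sum_noise_weight1.
under eq_bigr do rewrite !ffunE.
rewrite (sum_noise_weight_sites (fun y => spin (site_update u y x))
  (fun y => spin (site_update v y x)) uv).
rewrite !sum_site_weight_spin mulrACA -expr2 -/decay; congr (_ * _).
rewrite mulr_suml; apply: eq_bigr => u' _; rewrite mulr_sumr.
by apply: eq_bigr => v' _; rewrite mulrACA.
Qed.

Definition correlation n u v : state -> R :=
  iter n transfer (fun x => spin (x u) * spin (x v)).

(** The innermost [transfer] is the last time step. It turns a product of two spins into a
    combination of such products, so the recursion follows two walks backwards in time while the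
    initial state [x] stays fixed. *)
Lemma correlationS n u v x : correlation n.+1 u v x =
  if u == v then 1 else
  decay * \sum_u' \sum_v' walk u u' * walk v v' * correlation n u' v' x.
Proof.
have [<-|uv] := eqVneq u v.
  rewrite /correlation (_ : (fun x => _) = fun=> 1); last first.
    by apply/funext => y; rewrite spin_sqr.
  elim: n.+1 => //= m IH; rewrite (_ : iter m transfer _ = fun=> 1); last first.
    apply/funext => y; elim: m y {IH} => //= m IH y.
    rewrite /transfer; under eq_bigr do rewrite IH mulr1.
    exact: sum_noise_weight1.
  rewrite /transfer; under eq_bigr do rewrite mulr1.
  exact: sum_noise_weight1.
have mE : transfer (fun x => spin (x u) * spin (x v)) =
    (fun x => \sum_(w : V * V) (decay * (walk u w.1 * walk v w.2)) *
       (spin (x w.1) * spin (x w.2))).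
  apply/funext => y; rewrite transfer_spins (negbTE uv) pair_big /= mulr_sumr.
  by apply: eq_bigr => w _; rewrite !mulrA.
rewrite /correlation iterSr mE iter_transfer_sum pair_big /= mulr_sumr.
by apply: eq_bigr => w _; rewrite !mulrA.
Qed.

Lemma spin_norm b : `|spin b| = 1.
Proof. by rewrite /spin; case: b; rewrite ?normrN normr1. Qed.

Lemma walk_average (f : V -> V -> R) u v c :
  (forall u' v', `|f u' v'| <= c) ->
  `|\sum_u' \sum_v' walk u u' * walk v v' * f u' v'| <= c.
Proof.
move=> h.
apply: (@le_trans _ _ (\sum_u' \sum_v' walk u u' * walk v v' * c)).
  apply: le_trans (ler_norm_sum _ _ _) _; apply: ler_sum => u' _.
  apply: le_trans (ler_norm_sum _ _ _) _; apply: ler_sum => v' _.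
  rewrite normrM ger0_norm ?mulr_ge0 ?walk_ge0 //.
  by rewrite ler_wpM2l ?mulr_ge0 ?walk_ge0.
under eq_bigr do rewrite -mulr_suml -mulr_sumr sum_walk1 mulr1.
by rewrite -mulr_suml sum_walk1 mul1r.
Qed.

Section Limit.
Variables (L : V -> V -> R) (B : R).
Hypothesis L_fix : forall u v, L u v = if u == v then 1 else
  decay * \sum_u' \sum_v' walk u u' * walk v v' * L u' v'.
Hypothesis L_le : forall u v, `|L u v| <= B.

(** The recursion is a contraction with factor [decay] in the supremum norm, since averaging over
    walks does not increase this norm. *)
Lemma correlation_limit n u v x :
  `|correlation n u v x - L u v| <= decay ^+ n * (1 + B).
Proof.
have /andP[d0 d1] := decay_bounds; have d0' := ltW d0; have d1' := ltW d1.
have B0 : 0 <= B by apply: le_trans (L_le u v).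
elim: n u v => [|n IH] u v.
  rewrite expr0 mul1r /correlation /=; apply: le_trans (ler_normB _ _) _.
  by rewrite normrM !spin_norm mulr1 lerD2l.
rewrite correlationS L_fix; case: (eqVneq u v) => [_|uv].
  by rewrite subrr normr0; apply: mulr_ge0; [apply: exprn_ge0|apply: addr_ge0].
rewrite -mulrBr normrM (gtr0_norm d0) exprS -mulrA ler_wpM2l ?(ltW d0) //.
rewrite -sumrB; under eq_bigr do rewrite -sumrB.
under eq_bigr do under eq_bigr do rewrite -mulrBr.
exact: walk_average.
Qed.

Definition walk2 (u v : V) : R := \sum_w walk u w * walk w v.

Lemma walk2_ge0 u v : 0 <= walk2 u v.
Proof. by apply: sumr_ge0 => w _; rewrite mulr_ge0 ?walk_ge0. Qed.

Lemma sum_walk2 u : \sum_v walk2 u v = 1.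
Proof.
rewrite exchange_big /=; under eq_bigr do rewrite -mulr_sumr sum_walk1 mulr1.
exact: sum_walk1.
Qed.

(** The conditional expectation of the product of the spins of [u] now and two steps later, given
    that the current state is [x]; see [expect_lag2]. *)
Definition lag2 (u : V) (x : state) : R :=
  \sum_v (decay * walk2 u v) * (spin (x u) * spin (x v)).

Definition lag2_limit (u : V) : R := \sum_v (decay * walk2 u v) * L u v.

Lemma walk2_average u (f : V -> R) c : (forall v, `|f v| <= c) ->
  `|\sum_v (decay * walk2 u v) * f v| <= decay * c.
Proof.
move=> h; have /andP[d0 _] := decay_bounds; have d0' := ltW d0.
apply: (@le_trans _ _ (\sum_v (decay * walk2 u v) * c)).
  apply: le_trans (ler_norm_sum _ _ _) _; apply: ler_sum => v _.
  have c0 : 0 <= decay * walk2 u v := mulr_ge0 d0' (walk2_ge0 u v).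
  by rewrite normrM (ger0_norm c0) ler_wpM2l.
by rewrite -mulr_suml -mulr_sumr sum_walk2 mulr1.
Qed.

Lemma lag2_limit_le u : `|lag2_limit u| <= B.
Proof.
have /andP[d0 d1] := decay_bounds; have d0' := ltW d0; have d1' := ltW d1.
apply: (@le_trans _ _ (decay * B)); first exact: walk2_average.
by rewrite ler_piMl // (le_trans _ (L_le u u)).
Qed.

Lemma lag2_converges n u x :
  `|iter n transfer (lag2 u) x - lag2_limit u| <= decay ^+ n * (1 + B).
Proof.
have /andP[d0 d1] := decay_bounds; have d0' := ltW d0; have d1' := ltW d1.
have B0 : 0 <= B by apply: le_trans (L_le u u).
rewrite iter_transfer_sum -sumrB; under eq_bigr do rewrite -mulrBr.
apply: le_trans (walk2_average _ _) _; first by move=> v; apply: correlation_limit.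
by rewrite ler_piMl //; apply: mulr_ge0; [apply: exprn_ge0|apply: addr_ge0].
Qed.

End Limit.
End FiniteModel.

(** * Concentration of the repetition statistic *)

Section Trajectories.
Variables (R : realType) (V : finType) (G : sgraph V) (eps : R).
Hypothesis eps01 : 0 < eps < 1.
Hypothesis deg_gt0 : forall u, (0 < #|neighbours G u|)%N.

Local Notation state := (state V).
Local Notation noise := (noise V).
Local Notation spin := (@spin R).
Local Notation transfer := (transfer G eps).
Local Notation noise_weight := (noise_weight G eps).

(** A finite sample space for the initial state and the first [N] noises, on which expectations are
    finite sums. *)
Fixpoint outcome (N : nat) : finType :=
  if N is N'.+1 then (outcome N' * noise)%type else state.

(* Constant after time [N]. *)
Fixpoint trajectory (N : nat) : outcome N -> nat -> state :=
  match N with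
  | 0 => fun x _ => x
  | N'.+1 => fun w i => if (i <= N')%N then trajectory w.1 i
                        else update G (trajectory w.1 N') w.2
  end.

Fixpoint outcome_weight (N : nat) : outcome N -> R :=
  match N with
  | 0 => fun x => \prod_u bernoulli_pmf 2^-1 (x u)
  | N'.+1 => fun w => outcome_weight w.1 * noise_weight w.2
  end.

Definition expect (N : nat) (A : (nat -> state) -> R) : R :=
  \sum_(w : outcome N) outcome_weight w * A (trajectory w).

Definition adapted (N : nat) (A : (nat -> state) -> R) : Prop :=
  forall s s', (forall i, (i <= N)%N -> s i = s' i) -> A s = A s'.

Lemma adaptedW N M A : (N <= M)%N -> adapted N A -> adapted M A.
Proof. by move=> NM ad s s' h; apply: ad => i iN; apply: h; apply: leq_trans NM. Qed.

Lemma outcome_weight_ge0 N (w : outcome N) : 0 <= outcome_weight w.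
Proof.
elim: N w => [x|N IH [w z]] /=.
  by apply: prodr_ge0 => u _; rewrite /bernoulli_pmf; case: ifP => _; lra.
by rewrite mulr_ge0 // noise_weight_ge0.
Qed.

(** The Markov property: the last noise is summed out while [A], which does not see it, stays
    fixed. *)
Lemma expect_transfer N A f : adapted N A ->
  expect N.+1 (fun s => A s * f (s N.+1)) = expect N (fun s => A s * transfer f (s N)).
Proof.
move=> ad; rewrite /expect /=.
rewrite -(pair_bigA _ (fun w z => outcome_weight w * noise_weight z *
  (A (trajectory ((w, z) : outcome N.+1)) * f (trajectory ((w, z) : outcome N.+1) N.+1)))) /=.
apply: eq_bigr => w _; rewrite /transfer !mulr_sumr; apply: eq_bigr => z _.
rewrite ltnn (ad _ (trajectory w)); last by move=> i ->.
by rewrite -!mulrA; congr (_ * _); rewrite mulrCA.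
Qed.

Lemma expect_adapted1 N A : adapted N A -> expect N.+1 A = expect N A.
Proof.
move=> ad; have := @expect_transfer N A (fun=> 1) ad.
have -> : transfer (fun=> 1) = fun=> 1.
  apply/funext => x; rewrite /transfer; under eq_bigr do rewrite mulr1.
  exact: sum_noise_weight1.
have -> // : (fun s => A s * 1) = A.
by apply/funext => s; rewrite mulr1.
Qed.

Lemma expect_adapted N M A : adapted N A -> (N <= M)%N -> expect M A = expect N A.
Proof.
move=> ad /subnKC <-; elim: (M - N)%N => [|n IH]; first by rewrite addn0.
by rewrite addnS expect_adapted1 //; apply: adaptedW ad; apply: leq_addr.
Qed.

Lemma expect_iter_transfer N n A f : adapted N A ->
  expect (N + n) (fun s => A s * f (s (N + n)%N)) =
  expect N (fun s => A s * iter n transfer f (s N)).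
Proof.
elim: n f => [|n IH] f ad; first by rewrite addn0.
rewrite addnS expect_transfer; last by apply: adaptedW ad; apply: leq_addr.
by rewrite IH // iterSr.
Qed.

Lemma expectD N A B : expect N (fun s => A s + B s) = expect N A + expect N B.
Proof. by rewrite /expect -big_split; apply: eq_bigr => w _; rewrite mulrDr. Qed.

Lemma expectZ N c A : expect N (fun s => c * A s) = c * expect N A.
Proof. by rewrite /expect mulr_sumr; apply: eq_bigr => w _; rewrite mulrCA. Qed.

Lemma expect_sum N (I : Type) (r : seq I) (A : I -> (nat -> state) -> R) :
  expect N (fun s => \sum_(i <- r) A i s) = \sum_(i <- r) expect N (A i).
Proof.
rewrite /expect exchange_big; apply: eq_bigr => w _; exact: mulr_sumr.
Qed.

Lemma expect_le N A B : (forall s, A s <= B s) -> expect N A <= expect N B.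
Proof. by move=> AB; apply: ler_sum => w _; rewrite ler_wpM2l // outcome_weight_ge0. Qed.

Lemma sum_initial : \sum_(x : state) \prod_u bernoulli_pmf (2^-1 : R) (x u) = 1.
Proof.
rewrite -(bigA_distr_bigA (fun _ b => bernoulli_pmf 2^-1 b)) big1 // => u _.
by rewrite big_bool /bernoulli_pmf /=; lra.
Qed.

Lemma expect1 N : expect N (fun=> 1) = 1.
Proof.
rewrite (@expect_adapted 0) // /expect /= -[RHS]sum_initial.
by apply: eq_bigr => x _; rewrite mulr1.
Qed.

Lemma expect_cst N c : expect N (fun=> c) = c.
Proof. by rewrite -[in LHS](mulr1 c) expectZ expect1 mulr1. Qed.

Lemma expect_norm_le N A c : (forall s, `|A s| <= c) -> `|expect N A| <= c.
Proof.
move=> Ac; rewrite ler_norml -(expect_cst N c) -mulN1r -expectZ; apply/andP.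
split; apply: expect_le => s; have := Ac s; rewrite ler_norml => /andP[h1 h2] //.
by rewrite mulN1r.
Qed.

Section SecondMoment.
Variables (L : V -> V -> R) (B : R) (u : V).
Hypothesis L_fix : forall v w, L v w = if v == w then 1 else
  decay eps * \sum_v' \sum_w' walk R G v v' * walk R G w w' * L v' w'.
Hypothesis L_le : forall v w, `|L v w| <= B.

Local Notation lim := (lag2_limit G eps L u).

Definition deviation (i : nat) (s : nat -> state) : R :=
  spin (s i u) * spin (s i.+2 u) - lim.

Lemma deviation_adapted i : adapted i.+2 (deviation i).
Proof. by move=> s s' h; rewrite /deviation (h i.+2) // (h i) // -addn2 leq_addr. Qed.

Lemma B_ge0 : 0 <= B.
Proof. exact: le_trans (normr_ge0 _) (L_le u u). Qed.

Lemma deviation_le i s : `|deviation i s| <= 1 + B.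
Proof.
apply: le_trans (ler_normB _ _) _.
by rewrite normrM !spin_norm mulr1 lerD2l (lag2_limit_le eps01 deg_gt0 L_le).
Qed.

Lemma expect_lag2 j A : adapted j A ->
  expect j.+2 (fun s => A s * (spin (s j u) * spin (s j.+2 u))) =
  expect j (fun s => A s * lag2 G eps u (s j)).
Proof.
move=> ad.
have ad1 : adapted j.+1 (fun s => A s * spin (s j u)).
  by move=> s s' h; rewrite (adaptedW (leqnSn j) ad h) h.
transitivity (expect j.+2 (fun s => (A s * spin (s j u)) * (fun x => spin (x u)) (s j.+2))).
  by congr expect; apply/funext => s; rewrite mulrA.
rewrite (expect_transfer (fun x : state => spin (x u)) ad1).
have ad0 : adapted j (fun s => A s * spin (s j u)).
  by move=> s s' h; rewrite (ad _ _ h) h.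
rewrite (expect_transfer _ ad0); congr expect; apply/funext => s.
rewrite -mulrA; congr (_ * _).
have -> : transfer (fun x => spin (x u)) =
    fun x => \sum_v ((1 - eps) * walk R G u v) * spin (x v).
  apply/funext => x; rewrite transfer_spin // mulr_sumr.
  by apply: eq_bigr => v _; rewrite mulrA.
rewrite transfer_sum /lag2 mulr_sumr.
under eq_bigr do rewrite transfer_spin // mulr_sumr mulr_sumr mulr_sumr.
rewrite exchange_big /=; apply: eq_bigr => v _.
rewrite /walk2 mulr_sumr mulr_suml; apply: eq_bigr => w _.
rewrite /decay; ring.
Qed.

(** Conditioning on time j = i + 2 + n replaces the later deviation by the centred [lag2]. The
    earlier deviation is determined at time i + 2, so [lag2] then relaxes for [n] steps. *)
Lemma covariance_far i n N : ((i.+2 + n).+2 <= N)%N ->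
  `|expect N (fun s => deviation i s * deviation (i.+2 + n) s)| <=
  (1 + B) ^+ 2 * decay eps ^+ n.
Proof.
move=> jN; set j := (i.+2 + n)%N in jN *.
have ad : adapted j (deviation i).
  by apply: adaptedW (@deviation_adapted i); apply: leq_addr.
have adj2 : adapted j.+2 (fun s => deviation i s * deviation j s).
  move=> s s' h; rewrite (deviation_adapted h) (ad s s') // => k kj.
  by apply: h; rewrite (leq_trans kj) // ltnW.
rewrite (expect_adapted adj2 jN).
have -> : expect j.+2 (fun s => deviation i s * deviation j s) =
    expect j (fun s => deviation i s * (lag2 G eps u (s j) - lim)).
  transitivity (expect j.+2 (fun s => deviation i s * (spin (s j u) * spin (s j.+2 u))
     + (- lim) * deviation i s)).
    by congr expect; apply/funext => s; rewrite {2}/deviation; ring.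
  rewrite expectD expect_lag2 // expectZ (@expect_adapted j) //; last by rewrite -addn2 leq_addr.
  rewrite -expectZ -expectD; congr expect; apply/funext => s; ring.
have -> : expect j (fun s => deviation i s * (lag2 G eps u (s j) - lim)) =
    expect i.+2 (fun s => deviation i s * (iter n transfer (lag2 G eps u) (s i.+2) - lim)).
  transitivity (expect j (fun s => deviation i s * lag2 G eps u (s j)
     + (- lim) * deviation i s)).
    by congr expect; apply/funext => s; ring.
  rewrite expectD expect_iter_transfer; last exact: deviation_adapted.
  rewrite expectZ (@expect_adapted i.+2); last 2 first.
  - exact: deviation_adapted.
  - exact: leq_addr.
  rewrite -expectZ -expectD; congr expect; apply/funext => s; ring.
apply: expect_norm_le => s; rewrite normrM expr2 -mulrA [(1 + B) * decay eps ^+ n]mulrC.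
by apply: ler_pM => //; [exact: deviation_le|exact: lag2_converges].
Qed.

Lemma covariance_le i j N : (i <= j)%N -> (j.+2 <= N)%N ->
  `|expect N (fun s => deviation i s * deviation j s)| <=
  (1 + B) ^+ 2 / decay eps ^+ 2 * decay eps ^+ (j - i).
Proof.
have /andP[d0 d1] := decay_bounds eps01.
move=> ij jN; case: (leqP i.+2 j) => h.
  have jE : j = (i.+2 + (j - i.+2))%N by lia.
  rewrite {1}jE; apply: le_trans (covariance_far _) _; first by rewrite -jE.
  have -> : (j - i = 2 + (j - i.+2))%N by lia.
  by rewrite exprD mulrA divfK // expf_neq0 // gt_eqF.
(* Overlapping windows: here j - i <= 1, so the factor [decay eps ^- 2] makes the trivial bound
   sufficient. *)
apply: (@le_trans _ _ ((1 + B) ^+ 2)).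
  by apply: expect_norm_le => s; rewrite normrM expr2; apply: ler_pM => //; apply: deviation_le.
have key (a : R) : 0 < a -> a < 1 -> 1 <= (a ^+ 2)^-1 * a ^+ (j - i).
  move=> a0 a1; rewrite ler_pdivlMl ?exprn_gt0 // mulr1.
  by rewrite ler_wiXn2l ?ltW //; lia.
rewrite -mulrA; apply: ler_peMr; last exact: key.
by apply: exprn_ge0; rewrite addr_ge0 ?B_ge0.
Qed.

Lemma sum_decay_le m : \sum_(i < m) decay eps ^+ (m - i) <= (1 - decay eps)^-1.
Proof.
have /andP[d0 d1] := decay_bounds eps01.
move: (decay eps) d0 d1 => a a0 a1.
elim: m => [|m IH]; first by rewrite big_ord0 invr_ge0; lra.
rewrite big_ord_recr /= subSnn expr1.
under eq_bigr => i _ do rewrite (subSn (ltnW (ltn_ord i))) exprS.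
rewrite -mulr_sumr; apply: (@le_trans _ _ (a * (1 - a)^-1 + a)).
  by rewrite lerD2r ler_wpM2l // ltW.
rewrite -[X in _ <= X]mul1r -ler_pdivrMr ?invr_gt0 ?subr_gt0 // invrK.
rewrite mulrDl divfK; last by rewrite gt_eqF // subr_gt0.
nra.
Qed.

Definition variance_rate : R :=
  (1 + B) ^+ 2 / decay eps ^+ 2 * (1 + 2 * (1 - decay eps)^-1).

(** Induction on [m]: the new deviation adds its own square and twice its covariances with the
    earlier ones, which a geometric series bounds. *)
Lemma second_moment m N : (m.+2 <= N)%N ->
  expect N (fun s => (\sum_(1 <= i < m.+1) deviation i s) ^+ 2) <= m%:R * variance_rate.
Proof.
have /andP[d0 d1] := decay_bounds eps01.
elim: m => [|m IH] mN.
  rewrite mul0r; under eq_fun do rewrite big_nil expr0n /=.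
  by rewrite expect_cst.
have {}IH := IH (ltnW mN).
have sqE s : (\sum_(1 <= i < m.+2) deviation i s) ^+ 2 =
    (\sum_(1 <= i < m.+1) deviation i s) ^+ 2 +
    (2 * (\sum_(1 <= i < m.+1) deviation i s * deviation m.+1 s)
     + deviation m.+1 s * deviation m.+1 s).
  rewrite big_nat_recr //= -mulr_suml; ring.
under eq_fun do rewrite sqE.
rewrite !expectD expectZ expect_sum [X in _ <= X * _]mulrSr [X in _ <= X]mulrDl mul1r.
apply: lerD => //; rewrite /variance_rate mulrDr mulr1 addrC; apply: lerD.
  have := covariance_le (leqnn m.+1) mN; rewrite subnn expr0 mulr1.
  exact: le_trans (ler_norm _).
rewrite mulrCA; apply: ler_wpM2l => //.
apply: le_trans (ler_norm _) _; apply: le_trans (ler_norm_sum _ _ _) _.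
apply: (@le_trans _ _ (\sum_(1 <= i < m.+1)
    (1 + B) ^+ 2 / decay eps ^+ 2 * decay eps ^+ (m.+1 - i))).
  rewrite !big_nat; apply: ler_sum => i /andP[_ im].
  by apply: covariance_le => //; apply: ltnW.
rewrite -mulr_sumr ler_wpM2l //.
  apply: divr_ge0; apply: exprn_ge0; last exact: ltW.
  by rewrite addr_ge0 ?B_ge0.
apply: le_trans (sum_decay_le m); rewrite big_add1 big_mkord.
by apply: ler_sum => i _; rewrite subSS.
Qed.

Lemma deviation_chebyshev m N (c : R) : 0 < c -> (0 < m)%N -> (m.+2 <= N)%N ->
  expect N (fun s => (c <= `|m%:R^-1 * \sum_(1 <= i < m.+1) deviation i s|)%R%:R)
    <= variance_rate / c ^+ 2 / m%:R.
Proof.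
move=> c0 m0 mN.
have mR0 : 0 < m%:R :> R by rewrite ltr0n.
have k0 : 0 <= (c * m%:R) ^- 2 by rewrite invr_ge0 exprn_ge0 // mulr_ge0 // ltW.
apply: (@le_trans _ _ (expect N (fun s => (c * m%:R) ^- 2 *
    (\sum_(1 <= i < m.+1) deviation i s) ^+ 2))).
  apply: expect_le => s; case: (leP c) => h; last first.
    by apply: mulr_ge0 => //; apply: sqr_ge0.
  rewrite /= mulrC ler_pdivlMr ?exprn_gt0 ?mulr_gt0 // mul1r.
  rewrite -[X in _ <= X]real_normK ?num_real // ler_sqr ?nnegrE ?mulr_ge0 ?(ltW c0) //.
  by move: h; rewrite normrM gtr0_norm ?invr_gt0 // mulrC ler_pdivlMr.
rewrite expectZ.
apply: le_trans (ler_wpM2l k0 (second_moment mN)) _.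
rewrite le_eqVlt; apply/orP; left; apply/eqP; field.
by rewrite !gt_eqF.
Qed.

End SecondMoment.
End Trajectories.

(** * The law of the noisy voter model *)

Local Open Scope classical_set_scope.
Local Open Scope ring_scope.


Lemma has_pmf_preimage (d : measure_display) (T : measurableType d) (R : realType)
    (P : probability T R) (E : finType) (Z : T -> E) (p : E -> R) (B : pred E) :
  has_pmf P Z p ->
  measurable [set w | B (Z w)] /\ P [set w | B (Z w)] = (\sum_(z | B z) p z)%:E.
Proof.
move=> Zp; have -> : [set w | B (Z w)] =
    \bigcup_(z in [set` enum B]) Z @^-1` [set z].
  apply/seteqP; split => [w Bw|w [z /=]]; last by rewrite mem_enum => Bz ->.
  by exists (Z w) => //=; rewrite mem_enum.
split.
  by apply: fin_bigcup_measurable => [|z _]; [exact: finite_seq|exact: (Zp z).1].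
rewrite measure_fin_bigcup; first last.
- by move=> z _; exact: (Zp z).1.
- by apply/trivIsetP => z z' _ _ zz'; rewrite -subset0 => w [/= wz wz'];
  rewrite -wz -wz' eqxx in zz'.
- exact: finite_seq.
rewrite -fsbig_seq ?enum_uniq // big_enum -sumEFin.
by apply: eq_bigr => z _; exact: (Zp z).2.
Qed.

Section VoterModelLaw.
Context {d : measure_display} {T : measurableType d} {R : realType}.
Variables (P : probability T R) (eps : R) (V : finType) (G : sgraph V).
Variables (X : nat -> V -> T -> bool) (xi Y : nat -> V -> T -> bool).
Variable eta : nat -> V -> T -> V.
Hypothesis X0_pmf : forall u, has_pmf P (X 0%N u) (bernoulli_pmf 2^-1).
Hypothesis noise_pmf : forall t u, (1 <= t)%N ->
  [/\ has_pmf P (xi t u) (bernoulli_pmf eps),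
      has_pmf P (Y t u) (bernoulli_pmf 2^-1) &
      has_pmf P (eta t u) (uniform_pmf R (neighbours G u))].
Hypothesis indep : mutually_independent P (driving_events (X 0%N) xi Y eta).
Hypothesis X_rec : forall t u w, (1 <= t)%N ->
  X t u w = (xi t u w * Y t u w + (1 - xi t u w) *
    \sum_(v in neighbours G u) (eta t u w == v) * X t.-1 v w)%N :> nat.

Definition state_at (i : nat) (w : T) : state V := [ffun u => X i u w].

Definition noise_at (t : nat) (w : T) : noise V :=
  [ffun u => (xi t u w, Y t u w, eta t u w)].

Fixpoint outcome_at (N : nat) (w : T) : outcome V N :=
  match N with
  | 0 => state_at 0 w
  | N'.+1 => (outcome_at N' w, noise_at N'.+1 w)
  end.

Lemma state_at_rec t w :
  state_at t.+1 w = update G (state_at t w) (noise_at t.+1 w).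
Proof.
apply/ffunP => u; rewrite !ffunE /site_update /= ffunE.
have /= := @X_rec t.+1 u w isT.
case: (xi t.+1 u w) => /=.
  by rewrite mul1n mul0n addn0; case: (X _ _ _); case: (Y _ _ _).
rewrite mul0n add0n mul1n.
have -> : (\sum_(v in neighbours G u) (eta t.+1 u w == v) * X t v w)%N =
    ((eta t.+1 u w \in neighbours G u) && X t (eta t.+1 u w) w : nat).
  case: (boolP (_ \in _)) => [h|h] /=.
    rewrite (bigD1 (eta t.+1 u w)) //= eqxx mul1n big1 ?addn0 // => v /andP[_].
    by rewrite eq_sym => /negbTE ->.
  rewrite big1 // => v vu; case: eqP => // e; by rewrite e vu in h.
by case: (X _ _ _); case: (_ && _).
Qed.

Lemma trajectory_outcome_at N w i : (i <= N)%N ->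
  trajectory G (outcome_at N w) i = state_at i w.
Proof.
elim: N i => [|N IH] i /=; first by rewrite leqn0 => /eqP ->.
rewrite leq_eqVlt => /orP[/eqP ->|iN].
  by rewrite ltnn IH // -state_at_rec.
by rewrite -ltnS iN IH.
Qed.

Fixpoint initial (N : nat) : outcome V N -> state V :=
  match N with 0 => id | N'.+1 => fun z => initial z.1 end.

(* Junk value for [N <= t]. *)
Fixpoint noise_of (N : nat) : outcome V N -> nat -> noise V :=
  match N with
  | 0 => fun _ _ => [ffun u => (true, true, u)]
  | N'.+1 => fun z t => if (t < N')%N then noise_of z.1 t else z.2
  end.

Lemma outcome_atP N w (z : outcome V N) :
  outcome_at N w = z <->
  state_at 0 w = initial z /\
  forall t, (t < N)%N -> noise_at t.+1 w = noise_of z t.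
Proof.
elim: N z => [|N IH] z /=; first by split=> [->|[]].
case: z => z y /=; split=> [[/IH[h1 h2] <-]|[h1 h2]].
  split=> // t; rewrite ltnS leq_eqVlt => /orP[/eqP ->|tN]; first by rewrite ltnn.
  by rewrite tN h2.
have /IH -> : state_at 0 w = initial z /\
    forall t, (t < N)%N -> noise_at t.+1 w = noise_of z t.
  split=> // t tN; have := h2 t (ltnW tN); by rewrite tN.
by rewrite h2 // ltnn.
Qed.

Lemma outcome_weightE N (z : outcome V N) :
  outcome_weight G eps z = (\prod_u bernoulli_pmf 2^-1 (initial z u)) *
    \prod_(t < N) noise_weight G eps (noise_of z t).
Proof.
elim: N z => [|N IH] z /=; first by rewrite big_ord0 mulr1.
rewrite IH big_ord_recr /= ltnn mulrA; congr (_ * _ * _).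
by apply: eq_bigr => t _; rewrite ltn_ord.
Qed.

(** Indexes the finitely many driving variables that determine the first [N] steps; [driving_index]
    embeds it into the full index set. *)
Definition outcome_index (N : nat) : finType :=
  (V + ('I_N * V + ('I_N * V + 'I_N * V)))%type.

Definition driving_index (N : nat) (i : outcome_index N) :
    V + (nat * V + (nat * V + nat * V)) :=
  match i with
  | inl u => inl u
  | inr (inl (t, u)) => inr (inl (val t, u))
  | inr (inr (inl (t, u))) => inr (inr (inl (val t, u)))
  | inr (inr (inr (t, u))) => inr (inr (inr (val t, u)))
  end.

Definition driving_event (N : nat) (z : outcome V N)
    (i : V + (nat * V + (nat * V + nat * V))) : set T :=
  match i with
  | inl u => X 0%N u @^-1` [set initial z u]
  | inr (inl (t, u)) => xi t.+1 u @^-1` [set (noise_of z t u).1.1]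
  | inr (inr (inl (t, u))) => Y t.+1 u @^-1` [set (noise_of z t u).1.2]
  | inr (inr (inr (t, u))) => eta t.+1 u @^-1` [set (noise_of z t u).2]
  end.

Definition driving_prob (N : nat) (z : outcome V N) (i : outcome_index N) : R :=
  match i with
  | inl u => bernoulli_pmf 2^-1 (initial z u)
  | inr (inl (t, u)) => bernoulli_pmf eps (noise_of z t u).1.1
  | inr (inr (inl (t, u))) => bernoulli_pmf 2^-1 (noise_of z t u).1.2
  | inr (inr (inr (t, u))) => uniform_pmf R (neighbours G u) (noise_of z t u).2
  end.

Lemma driving_event_pmf N (z : outcome V N) (i : outcome_index N) :
  measurable (driving_event z (driving_index i)) /\
  P (driving_event z (driving_index i)) = (driving_prob z i)%:E.
Proof.
case: i => [u|[[t u]|[[t u]|[t u]]]] /=; first exact: X0_pmf.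
- by have [h _ _] := @noise_pmf t.+1 u isT; apply: h.
- by have [_ h _] := @noise_pmf t.+1 u isT; apply: h.
- by have [_ _ h] := @noise_pmf t.+1 u isT; apply: h.
Qed.

Lemma driving_index_inj N : injective (@driving_index N).
Proof.
move=> [u|[[t u]|[[t u]|[t u]]]] [v|[[s v]|[[s v]|[s v]]]] //= [].
- by move=> ->.
- by move=> /val_inj -> ->.
- by move=> /val_inj -> ->.
- by move=> /val_inj -> ->.
Qed.

(** A prescribed outcome is the intersection of one event per driving variable, so mutual
    independence gives the product weight. *)
Lemma outcome_at_pmf N : has_pmf P (outcome_at N) (@outcome_weight R V G eps N).
Proof.
move=> z; pose J := [seq driving_index i | i <- enum (outcome_index N)].
have E : outcome_at N @^-1` [set z] = \bigcap_(i in [set` J]) driving_event z i.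
  apply/seteqP; split => [w /= /outcome_atP[h1 h2] j /mapP[i _ ->]|w h].
    case: i => [u|[[t u]|[[t u]|[t u]]]] /=; rewrite -?h1 -?(h2 _ (ltn_ord t)) ffunE //.
  have {}h i : driving_event z (@driving_index N i) w.
    by apply: h; rewrite /= map_f // mem_enum.
  apply/outcome_atP; split.
    by apply/ffunP => u; rewrite ffunE; apply: (h (inl u)).
  move=> t tN; apply/ffunP => u; rewrite ffunE.
  have := h (inr (inl (Ordinal tN, u))) => /= ->.
  have := h (inr (inr (inl (Ordinal tN, u)))) => /= ->.
  have := h (inr (inr (inr (Ordinal tN, u)))) => /= ->.
  by case: (noise_of z t u) => [[]].
rewrite E; split.
  apply: fin_bigcap_measurable => [|j /= /mapP[i _ ->]]; first exact: finite_seq.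
  exact: (driving_event_pmf z i).1.
rewrite indep; first last.
- by move=> j _; case: j => [u|[[t u]|[[t u]|[t u]]]] /=; eexists.
- by rewrite map_inj_uniq ?enum_uniq //; apply: driving_index_inj.
rewrite big_map big_enum /= (eq_bigr _ (fun i _ => (driving_event_pmf z i).2)).
rewrite prodEFin outcome_weightE; congr EFin.
rewrite !big_sumType /=; congr (_ * _).
rewrite /noise_weight; under [RHS]eq_bigr do rewrite /site_weight !big_split /=.
rewrite !big_split /= -mulrA; congr (_ * (_ * _)); rewrite pair_big /=;
  by apply: eq_bigr => -[t u] _.
Qed.

(** Transfers the finite computations to an arbitrary probability space that carries the model. *)
Lemma voter_model_law N (B : (nat -> state V) -> bool) :
  (forall s s', (forall i, (i <= N)%N -> s i = s' i) -> B s = B s') ->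
  measurable [set w | B (fun i => state_at i w)] /\
  P [set w | B (fun i => state_at i w)] =
    (expect G eps N (fun s => (B s)%:R))%:E.
Proof.
move=> Bad.
have -> : [set w | B (fun i => state_at i w)] =
    [set w | B (trajectory G (outcome_at N w))].
  apply/seteqP; split => w /=; rewrite (Bad _ (trajectory G (outcome_at N w))) //;
    by move=> i iN; rewrite trajectory_outcome_at.
have [mB ->] := has_pmf_preimage (fun z => B (trajectory G z)) (@outcome_at_pmf N).
split => //; congr EFin; rewrite /expect big_mkcond; apply: eq_bigr => z _.
by case: (B _); rewrite ?mulr1 ?mulr0.
Qed.

End VoterModelLaw.

Lemma cvg_probability1 (R : realType) (f : nat -> \bar R) :
  (forall e : R, 0 < e -> exists N, forall t, (N <= t)%N ->
    ((1 - e)%:E <= f t <= 1)%E) ->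
  f @ \oo --> 1%E.
Proof.
move=> fe; apply/fine_cvgP; split.
  have [N hN] := fe 1 ltr01; exists N => //= t /hN; rewrite subrr.
  by rewrite fin_numE => /andP[]; case: (f t).
apply/cvgrPdist_le => e e0; have [N hN] := fe _ e0.
exists N => //= t /hN /andP[]; case: (f t) => //= r; rewrite !lee_fin => er r1.
by rewrite ger0_norm ?subr_ge0 // lerBlDr -lerBlDl.
Qed.

Lemma probability_ge_of_setC (d : measure_display) (T : measurableType d)
    (R : realType) (P : probability T R) (A : set T) (e : R) :
  measurable A -> (P (~` A) <= e%:E)%E -> ((1 - e)%:E <= P A)%E.
Proof.
move=> mA; rewrite probability_setC // -[P A]fineK ?fin_num_measure //.
by rewrite -EFinB !lee_fin lerBlDr -lerBlDl.
Qed.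

(** * Convergence of the repetition statistic *)

Section RepetitionLimit.
Variables (R : realType) (V : finType) (G : sgraph V) (u : V) (eps : R).
Variables (L : V -> V -> R) (B : R).
Hypothesis eps01 : 0 < eps < 1.
Hypothesis deg_gt0 : forall u, (0 < #|neighbours G u|)%N.
Hypothesis L_fix : forall v w, L v w = if v == w then 1 else
  decay eps * \sum_v' \sum_w' walk R G v v' * walk R G w w' * L v' w'.
Hypothesis L_le : forall v w, `|L v w| <= B.

Definition repetition_limit : R := (1 + lag2_limit G eps L u) / 2.

(** The indicator that two spins agree is (1 + their product) / 2. *)
Lemma repetition_deviation (m : nat) (s : nat -> state V) : (0 < m)%N ->
  repetition_statistic R 2 (fun i : 'I_(m.+2).+1 => s i u) - repetition_limit =
  2^-1 * (m%:R^-1 * \sum_(1 <= i < m.+1) deviation G eps L u i s).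
Proof.
move=> m0; have mR : m%:R != 0 :> R by rewrite pnatr_eq0 -lt0n.
rewrite /repetition_statistic (_ : m.+2 - 2 = m)%N; last by lia.
rewrite mulrCA [in RHS]mulr_sumr.
rewrite (_ : repetition_limit = m%:R^-1 * \sum_(1 <= i < m.+1) repetition_limit).
  rewrite -mulrBr -sumrB; congr (_ * _); rewrite !big_nat; apply: eq_bigr => i /andP[_ im].
  rewrite inordK; last by rewrite ltnS ltnW // ltnW.
  rewrite inordK; last by rewrite addn2 !ltnS.
  rewrite /repetition_limit /deviation addn2.
  by case: (s i u); case: (s i.+2 u); rewrite /spin /=; field.
by rewrite sumr_const_nat subSS subn0 -[X in _ = _ * X]mulr_natl mulrA mulVf // mul1r.
Qed.

(** Chebyshev's inequality for the deviations at level 2c. The constant [K] is the same for all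
    probability spaces and all [m]. *)
Lemma repetition_concentrates (c : R) : 0 < c ->
  exists K : R, forall (d : measure_display) (T : measurableType d)
    (P : probability T R) (X : nat -> V -> T -> bool) (m : nat),
  noisy_voter_model P eps G X -> (0 < m)%N ->
  measurable [set w | `|repetition_statistic R 2
       (fun i : 'I_(m.+2).+1 => X i u w) - repetition_limit| < c] /\
  (P [set w | (c <= `|repetition_statistic R 2
       (fun i : 'I_(m.+2).+1 => X i u w) - repetition_limit|)%R] <= (K / m%:R)%:E)%E.
Proof.
move=> c0; exists (variance_rate eps B / (2 * c) ^+ 2) => d T P X m.
move=> [_ _ [xi [Y [eta [h1 h2 h3 h4]]]]] m0.
pose D s := m%:R^-1 * \sum_(1 <= i < m.+1) deviation G eps L u i s.
have Dad s s' : (forall i, (i <= m.+2)%N -> s i = s' i) -> D s = D s'.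
  move=> h; rewrite /D; congr (_ * _); rewrite !big_nat; apply: eq_bigr => i /andP[_ im].
  by apply: deviation_adapted => j ji; apply: h; rewrite (leq_trans ji).
have repE w : `|repetition_statistic R 2 (fun i : 'I_(m.+2).+1 => X i u w) - repetition_limit|
    = 2^-1 * `|D (fun i => state_at X i w)|.
  have <- : `|2^-1 * D (fun i => state_at X i w)| = 2^-1 * `|D (fun i => state_at X i w)|.
    by rewrite normrM ger0_norm.
  rewrite -repetition_deviation //.
  have -> // : (fun i : 'I_(m.+2).+1 => state_at X i w u) = (fun i => X i u w).
  by apply/funext => i; rewrite ffunE.
split.
  have -> : [set w | `|repetition_statistic R 2 (fun i : 'I_(m.+2).+1 => X i u w)
      - repetition_limit| < c] = [set w | 2^-1 * `|D (fun i => state_at X i w)| < c].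
    by apply/seteqP; split => w /=; rewrite repE.
  by have [] := voter_model_law h1 h2 h3 h4 (N := m.+2)
    (B := fun s => 2^-1 * `|D s| < c) => // s s' /Dad ->.
have -> : [set w | (c <= `|repetition_statistic R 2 (fun i : 'I_(m.+2).+1 => X i u w)
      - repetition_limit|)%R] = [set w | (2 * c <= `|D (fun i => state_at X i w)|)%R].
  by apply/seteqP; split => w /=; rewrite repE ler_pdivlMl.
have [|_ ->] := voter_model_law h1 h2 h3 h4 (N := m.+2)
    (B := fun s => 2 * c <= `|D s|); first by move=> s s' /Dad ->.
by rewrite lee_fin; apply: deviation_chebyshev => //; rewrite mulr_gt0.
Qed.

End RepetitionLimit.

Lemma repetition_distinguishes (R : realType) (eps : R) (V1 V2 : finType)
    (G1 : sgraph V1) (u1 : V1) (G2 : sgraph V2) (u2 : V2)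
    (L1 : V1 -> V1 -> R) (L2 : V2 -> V2 -> R) :
  0 < eps < 1 ->
  (forall u, (0 < #|neighbours G1 u|)%N) -> (forall u, (0 < #|neighbours G2 u|)%N) ->
  (forall v w, L1 v w = if v == w then 1 else
    decay eps * \sum_v' \sum_w' walk R G1 v v' * walk R G1 w w' * L1 v' w') ->
  (forall v w, L2 v w = if v == w then 1 else
    decay eps * \sum_v' \sum_w' walk R G2 v v' * walk R G2 w w' * L2 v' w') ->
  lag2_limit G1 eps L1 u1 != lag2_limit G2 eps L2 u2 ->
  distinguishes (repetition_statistic R 2) eps G1 u1 G2 u2.
Proof.
move=> eps01 deg1 deg2 fix1 fix2 l12.
have bound (V : finType) (L : V -> V -> R) : exists B : R, forall v w, `|L v w| <= B.
  exists (\sum_v \sum_w `|L v w|) => v w.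
  rewrite (bigD1 v) //= (bigD1 w) //= -addrA lerDl addr_ge0 //.
    by apply: sumr_ge0.
  by apply: sumr_ge0 => v' _; apply: sumr_ge0.
have [B1 L1B] := bound _ L1; have [B2 L2B] := bound _ L2.
set c1 := repetition_limit G1 u1 eps L1; set c2 := repetition_limit G2 u2 eps L2.
pose c := `|c1 - c2| / 2.
have c0 : 0 < c.
  rewrite divr_gt0 // normr_gt0 subr_eq0; apply: contra l12 => /eqP e.
  apply/eqP; move: e; rewrite /c1 /c2 /repetition_limit; lra.
have [K1 h1] := repetition_concentrates u1 eps01 deg1 fix1 L1B c0.
have [K2 h2] := repetition_concentrates u2 eps01 deg2 fix2 L2B c0.
(* Balls around the two limits with half their distance as radius; they do not depend on time. *)
exists (fun=> [set x | `|x - c1| < c]), (fun=> [set x | `|x - c2| < c]); split.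
  move=> _; rewrite -subset0 => x [/= x1 x2].
  have : `|c1 - c2| < c + c.
    rewrite (_ : c1 - c2 = (x - c2) - (x - c1)); last by ring.
    by apply: le_lt_trans (ler_normB _ _) _; rewrite addrC ltrD.
  by rewrite -splitr ltxx.
move=> d T P X1 X2 V1m V2m; apply: cvg_probability1 => e e0.
exists (3 + Num.truncn ((K1 + K2) / e))%N => t tN.
have [m [m0 tE me]] : exists m, [/\ (0 < m)%N, t = m.+2 & (K1 + K2) / m%:R <= e].
  exists (t - 2)%N; have t2 : (0 < t - 2)%N by lia.
  split=> //; first by lia.
  rewrite ler_pdivrMr ?ltr0n // mulrC -ler_pdivrMr //.
  apply: le_trans (ltW (truncnS_gt _)) _; rewrite ler_nat.
  by rewrite -(leq_add2l 2) subnKC // (leq_trans _ tN) // add2n.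
rewrite tE; have [mA1 pA1] := h1 _ _ _ _ _ V1m m0; have [mA2 pA2] := h2 _ _ _ _ _ V2m m0.
set A1 := [set w | _] in mA1; set A2 := [set w | _] in mA2.
have C1 : (P (~` A1) <= (K1 / m%:R)%:E)%E.
  apply: le_trans pA1; rewrite le_eqVlt; apply/orP; left; apply/eqP; congr (P _).
  by apply/seteqP; split => w /=; rewrite leNgt => /negP.
have C2 : (P (~` A2) <= (K2 / m%:R)%:E)%E.
  apply: le_trans pA2; rewrite le_eqVlt; apply/orP; left; apply/eqP; congr (P _).
  by apply/seteqP; split => w /=; rewrite leNgt => /negP.
rewrite -[X in (_ <= P X <= _)%E]/(A1 `&` A2).
rewrite probability_le1 ?andbT; last exact: measurableI.
apply: probability_ge_of_setC; first exact: measurableI.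
rewrite classical_sets.setCI; apply: le_trans (measureU2 P (measurableC mA1) (measurableC mA2)) _.
apply: le_trans (leeD C1 C2) _.
by rewrite -EFinD lee_fin -mulrDl.
Qed.

(** * Almost all noise levels *)

Lemma countable_roots (R : realType) (p : {poly R}) :
  p != 0 -> countable [set x | root p x].
Proof.
move=> p0; apply: finite_set_countable; apply: contrapT => inf.
have [X XA pX] := infinite_set_fset (size p) inf.
have rX : all (root p) (finmap.enum_fset X) by apply/allP => x xX; apply: XA.
by have := max_poly_roots p0 rX (finmap.fset_uniq X); rewrite ltnNge pX.
Qed.

Lemma walk2_return (R : realType) (V : finType) (G : sgraph V) (u : V) :
  walk2 R G u u = return2 R G u.
Proof.
rewrite /walk2 sum_walk /return2; congr (_ * _); apply: eq_bigr => w.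
rewrite inE => uw; rewrite /walk /uniform_pmf ifT // inE adj_sym //.
Qed.

Lemma ae_repetition_distinguishes (R : realType) (V1 V2 : finType)
    (G1 : sgraph V1) (u1 : V1) (G2 : sgraph V2) (u2 : V2) :
  (forall u, (0 < #|neighbours G1 u|)%N) -> (forall u, (0 < #|neighbours G2 u|)%N) ->
  return2 R G1 u1 != return2 R G2 u2 ->
  {ae @lebesgue_measure R, forall eps : R, 0 < eps < 1 ->
     distinguishes (repetition_statistic R 2) eps G1 u1 G2 u2}.
Proof.
move=> deg1 deg2 c12.
have [D1 [N1 [D10 N10 fix1]]] := rational_meeting_function (walk R G1).
have [D2 [N2 [D20 N20 fix2]]] := rational_meeting_function (walk R G2).
pose M1 := \sum_v walk2 R G1 u1 v *: N1 u1 v.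
pose M2 := \sum_v walk2 R G2 u2 v *: N2 u2 v.
have at0 (V : finType) (G : sgraph V) u (N : V -> V -> {poly R}) :
    (forall v w, (N v w).[0] = (v == w)%:R) ->
    (\sum_v walk2 R G u v *: N u v).[0] = return2 R G u.
  move=> N0; rewrite horner_sum (bigD1 u) //= hornerZ N0 eqxx mulr1 walk2_return.
  rewrite big1 ?addr0 // => v vu; by rewrite hornerZ N0 eq_sym (negbTE vu) mulr0.
(* Where [H] does not vanish, both linear systems are solvable by division and the two limits
   differ. *)
pose H := D1 * D2 * (M1 * D2 - M2 * D1).
have H0 : H.[0] != 0.
  rewrite /H !(hornerM, hornerD, hornerN) !at0 // D10 D20 !mulr1 mul1r.
  by rewrite subr_eq0.
(* [Q] expresses [H] in terms of eps. It is a nonzero polynomial because eps = 1 gives a = 0, where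
   [H] is the difference of the return probabilities. *)
pose Q := H \Po ((1 - 'X) ^+ 2).
have QE eps : Q.[eps] = H.[decay eps] by rewrite horner_comp !hornerE.
have Q0 : Q != 0.
  apply: contraNneq H0 => Q0; have := QE 1.
  by rewrite Q0 horner0 /decay subrr expr0n /= => <-.
exists [set x | root Q x]; split.
- exact: countable_measurable (countable_roots Q0).
- exact: countable_lebesgue_measure0 (countable_roots Q0).
move=> eps /= nd; apply: contrapT => /negP; rewrite rootE QE => Qn; apply: nd => eps01.
move: Qn; rewrite /H !(hornerM, hornerD, hornerN) !mulf_eq0 !negb_or.
set a := decay eps => /andP[/andP[D1a D2a]].
rewrite subr_eq0 => MD.
pose L1 v w := (N1 v w).[a] / D1.[a]; pose L2 v w := (N2 v w).[a] / D2.[a].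
have fixL (V : finType) (G : sgraph V) (N : V -> V -> {poly R}) (D : {poly R}) :
    D.[a] != 0 -> (forall v w, (N v w).[a] = if v == w then D.[a] else
       a * \sum_v' \sum_w' walk R G v v' * walk R G w w' * (N v' w').[a]) ->
    forall v w, (N v w).[a] / D.[a] = if v == w then 1 else
      a * \sum_v' \sum_w' walk R G v v' * walk R G w w' * ((N v' w').[a] / D.[a]).
  move=> Da fixN v w; rewrite fixN; case: ifP => _; first by rewrite mulfV.
  rewrite -mulrA; congr (_ * _); rewrite mulr_suml; apply: eq_bigr => v' _.
  by rewrite mulr_suml; apply: eq_bigr => w' _; rewrite mulrA.
have limE (V : finType) (G : sgraph V) u (N : V -> V -> {poly R}) (D : {poly R}) :
    lag2_limit G eps (fun v w => (N v w).[a] / D.[a]) u =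
    a * ((\sum_v walk2 R G u v *: N u v).[a] / D.[a]).
  rewrite /lag2_limit horner_sum mulr_suml mulr_sumr; apply: eq_bigr => v _.
  by rewrite hornerZ !mulrA.
apply: (@repetition_distinguishes _ _ _ _ _ _ _ _ L1 L2) => //.
- exact: fixL.
- exact: fixL.
rewrite /L1 /L2 !limE -/M1 -/M2.
have /andP[a0 _] := decay_bounds eps01.
by rewrite (inj_eq (mulfI (lt0r_neq0 a0))) eqr_div.
Qed.

Lemma all_close_degree_gt0 (V : finType) (G : sgraph V) (u : V) :
  (2 <= #|V|)%N -> all_close G -> (0 < #|neighbours G u|)%N.
Proof.
move=> V2 /forallP/(_ u)/forallP close.
have [v vu] : exists v, u != v.
  have : (0 < #|predC1 u|)%N by rewrite cardC1; lia.
  by case/card_gt0P => v; rewrite inE eq_sym; exists v.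
apply/card_gt0P; have /implyP/(_ vu)/orP[uv|] := close v.
  by exists v; rewrite inE.
by case/existsP => w /andP[uw _]; exists w; rewrite inE.
Qed.

Lemma uniform_pair_pmf (d : measure_display) (T : measurableType d) (R : realType)
    (P : probability T R) (E : finType) (Z1 Z2 : T -> E) :
  has_pmf P Z1 (uniform_pmf R [set: E]%SET) ->
  has_pmf P Z2 (uniform_pmf R [set: E]%SET) ->
  (forall A B : set E,
     P (Z1 @^-1` A `&` Z2 @^-1` B) = (P (Z1 @^-1` A) * P (Z2 @^-1` B))%E) ->
  has_pmf P (fun w => (Z1 w, Z2 w)) (fun _ : E * E => #|{: E * E}|%:R^-1).
Proof.
move=> u1 u2 ind [z1 z2].
have -> : (fun w => (Z1 w, Z2 w)) @^-1` [set (z1, z2)] =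
    Z1 @^-1` [set z1] `&` Z2 @^-1` [set z2].
  by apply/seteqP; split => w /= [-> ->].
split; first by apply: measurableI; [exact: (u1 z1).1|exact: (u2 z2).1].
rewrite ind (u1 z1).2 (u2 z2).2 -EFinM /uniform_pmf !finset.in_setT cardsT.
by rewrite card_prod natrM invfM.
Qed.

Theorem theorem1p5 (R : realType)
  (d : nat -> measure_display) (T : forall n : nat, measurableType (d n))
  (P : forall n : nat, probability (T n) R)
  (G1 G2 : forall n : nat, T n -> sgraph 'I_n)
  (G1_unif : forall n : nat,
     has_pmf (P n) (G1 n) (uniform_pmf R [set: sgraph 'I_n]%SET))
  (G2_unif : forall n : nat,
     has_pmf (P n) (G2 n) (uniform_pmf R [set: sgraph 'I_n]%SET))
  (G12_indep : forall (n : nat) (A B : set (sgraph 'I_n)),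
     P n (G1 n @^-1` A `&` G2 n @^-1` B) =
     (P n (G1 n @^-1` A) * P n (G2 n @^-1` B))%E) :
  (fun n : nat => P n [set w |
     [/\ connected_graph (G1 n w), connected_graph (G2 n w) &
      forall u1 u2 : 'I_n,
        {ae @lebesgue_measure R, forall eps : R, 0 < eps < 1 ->
          distinguishes (repetition_statistic R 2) eps
            (G1 n w) u1 (G2 n w) u2}]]) @ \oo --> 1%E.
Proof.
apply: cvg_probability1 => e e0.
have [N smallN] := card_not_distinct_returns_small e0.
exists (maxn 2 N) => n; rewrite geq_max => /andP[n2 Nn].
pose good (p : sgraph 'I_n * sgraph 'I_n) : Prop :=
  [/\ connected_graph p.1, connected_graph p.2 & forall u1 u2 : 'I_n,
    {ae @lebesgue_measure R, forall eps : R, 0 < eps < 1 ->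
      distinguishes (repetition_statistic R 2) eps p.1 u1 p.2 u2}].
have distinct_good p : distinct_returns R p -> good p.
  case/and3P => c1 c2 /forallP sep; split; [exact: all_close_connected..|].
  move=> u1 u2; apply: ae_repetition_distinguishes.
  - by move=> u; apply: all_close_degree_gt0; rewrite ?card_ord.
  - by move=> u; apply: all_close_degree_gt0; rewrite ?card_ord.
  - by have /forallP := sep u1; apply.
set E := [set w | _].
(* The event is a function of a pair of random elements of a finite set, which makes it
   measurable. *)
have E_good : E = [set w | `[< good (G1 n w, G2 n w) >]].
  by apply/seteqP; split => w /= /asboolP.
have Zpmf := uniform_pair_pmf (G1_unif n) (G2_unif n) (G12_indep n).
have mE : measurable E.
  by rewrite E_good; have [] := has_pmf_preimage (fun p => `[< good p >]) Zpmf.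
rewrite probability_le1 // andbT; apply: probability_ge_of_setC => //.
have [mB PB] := has_pmf_preimage (fun p => ~~ distinct_returns R p) Zpmf.
apply: (@le_trans _ _ (P n [set w | ~~ distinct_returns R (G1 n w, G2 n w)])).
  apply: le_measure; [rewrite inE; exact: measurableC|rewrite inE; exact: mB|].
  rewrite E_good => w ngood; apply/negP => /distinct_good g; apply: ngood.
  exact/asboolP.
rewrite PB lee_fin sumr_const -[X in X <= _]mulr_natl.
rewrite ler_pdivrMr ?ltr0n; last by rewrite card_prod muln_gt0 card_sgraph_gt0.
apply: le_trans (smallN 'I_n _); last by rewrite card_ord.
by rewrite ler_nat; apply: subset_leq_card; apply/fintype.subsetP => p; rewrite inE.
Qed.
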